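(* Let $p$ be an atoral stable polynomial on $\mathbb{D}^2$, let the real numbers $\mathfrak{p}_1,\dots,\mathfrak{p}_M$ denote the (distinct) finite integrability indices of $p^2$, and let $\mathfrak{p}_{M+1}=\infty$. Then $M\le4N_{\mathbb{T}^2}(p,\tilde p)$, and for each $q\in\mathbb{C}[z_1,z_2]$ there is a $j$ with $1\le j\le M+1$ such that $$\mathfrak{p}_j=\sup_{\mathfrak{p}'>0}\left\{\mathfrak{p}':\partial_{z_1}\!\left(\tfrac qp\right)\in L^{\mathfrak{p}'}(\mathbb{T}^2)\right\}.$$
   Context: $\mathbb{D}$ is the open unit disk, $\mathbb{T}$ the unit circle. For $p\in\mathbb{C}[z_1,z_2]$ of bidegree $(n_1,n_2)$, $\tilde p(z)=z_1^{n_1}z_2^{n_2}\overline{p(1/\bar z_1,1/\bar z_2)}$. $p$ is atoral stable on $\mathbb{D}^2$ if it has no zeros in $\mathbb{D}^2$ and no nonconstant factor in common with $\tilde p$; such $p$ has finitely many zeros on $\mathbb{T}^2$, each of which is a zero of $\tilde p$. A (possibly infinite) number $\mathfrak{p}>0$ is an integrability index of an atoral stable polynomial $P$ if there is $Q\in\mathbb{C}[z_1,z_2]$ with $\mathfrak{p}=\sup\{\mathfrak{p}'>0:Q/P\in L^{\mathfrak{p}'}(\mathbb{T}^2)\}$. For $\tau\in\mathbb{T}^2$, $R_\tau$ is the ring of convergent power series centered at $\tau$, and $N_\tau(p,\tilde p)=\dim_{\mathbb{C}}\left(R_\tau/(p,\tilde p)R_\tau\right)$ is the intersection multiplicity of $p$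 and $\tilde p$ at $\tau$. $N_{\mathbb{T}^2}(p,\tilde p)$ is the sum of $N_\tau(p,\tilde p)$ over all common zeros $\tau$ of $p,\tilde p$ on $\mathbb{T}^2$. *)

(* Defs.v *)
From mathcomp Require Export all_boot all_order all_algebra.
From mathcomp.real_closed Require Export complex.
From mathcomp Require Export mathcomp_extra boolp classical_sets functions.
From mathcomp Require Export cardinality reals ereal topology normedtype esum.
From mathcomp Require Export derive trigo exp measure lebesgue_measure.
From mathcomp Require Export lebesgue_integral.

Set Implicit Arguments.
Unset Strict Implicit.
Unset Printing Implicit Defensive.

Import Order.TTheory GRing.Theory Num.Theory.
Import numFieldNormedType.Exports.

Local Open Scope classical_set_scope.
Local Open Scope ring_scope.

(* C[z1, z2] is {poly {poly R[i]}} with the conventions of polyXY: the outer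
   variable 'X is z1, the inner variable 'Y is z2, and p.[z1, z2] is the value
   of p at (z1, z2). *)

Section Defs.
Variable R : realType.
Local Notation C := R[i].
Local Notation modc := (@ComplexField.Normc.normc R).
Implicit Types (p q : {poly {poly C}}) (tau : C * C).

Definition deg1 p : nat := (size p).-1.
Definition deg2 p : nat := (sizeY p).-1.

Definition reversal p : {poly {poly C}} :=
  \poly_(i < (deg1 p).+1) \poly_(j < (deg2 p).+1)
    ((p`_(deg1 p - i))`_(deg2 p - j))^*%C.

Lemma size_coef_deg2 p i : (size (p`_i)%R <= (deg2 p).+1)%N.
Proof.
apply: leq_trans (leqSpred _).
have [lti|lei] := ltnP i (size p); last by rewrite nth_default ?size_poly0.
exact: (@leq_bigmax _ (fun k : 'I_(size p) => size (p`_k)%R) (Ordinal lti)).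
Qed.

Lemma horner_reversal p (z1 z2 : C) : z1 != 0 -> z2 != 0 ->
  (reversal p).[z1, z2] =
    z1 ^+ deg1 p * z2 ^+ deg2 p * (p.[(z1^*%C)^-1, (z2^*%C)^-1])^*%C.
Proof.
move=> z10 z20.
have cv (z : C) : ((z^*%C)^-1)^*%C = z^-1 by rewrite conjc_inv conjcK.
have cM (z w : C) : (z * w)^*%C = z^*%C * w^*%C by rewrite rmorphM.
have cX (z : C) k : (z ^+ k)^*%C = z^*%C ^+ k by rewrite rmorphXn.
have e (z : C) m k : (k < m.+1)%N -> z != 0 -> z ^+ (m - k) = z ^+ m * z^-1 ^+ k.
  by move=> lk z0; rewrite exprVn expfB_cond ?(negPf z0).
rewrite (@horner_coef_wide _ (deg1 p).+1 p) ?leqSpred//.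
rewrite /reversal horner_poly !horner_sum rmorph_sum mulr_sumr.
rewrite (reindex_inj rev_ord_inj); apply: eq_bigr => i _.
have li := ltn_ord i.
rewrite /= subSS subKn // -!polyC_exp !hornerM !hornerC.
rewrite horner_poly (@horner_coef_wide _ (deg2 p).+1 p`_i) ?size_coef_deg2//.
rewrite cM cX cv e// rmorph_sum mulr_suml [in RHS]mulr_suml [in RHS]mulr_sumr.
rewrite (reindex_inj rev_ord_inj); apply: eq_bigr => j _.
have lj := ltn_ord j.
rewrite /= subSS subKn // cM cX cv e//.
have aux (x A B b d : C) : x * (B * d) * (A * b) = A * B * (x * d * b).
  rewrite (mulrC _ (A * b)) -!mulrA; congr (_ * _).
  by rewrite (mulrCA x B) (mulrCA b B) (mulrC b) -mulrA.
exact: aux.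
Qed.

Definition atoral_stable p : Prop :=
  (forall z1 z2 : C, `|z1| < 1 -> `|z2| < 1 -> p.[z1, z2] != 0) /\
  (forall d u v : {poly {poly C}}, p = d * u -> reversal p = d * v ->
     exists c : C, d = c%:P%:P).

Definition cis (t : R) : C := (cos t +i* sin t)%C.

Definition in_Lp (a : R) (f : C * C -> C) : Prop :=
  (lebesgue_measure \x lebesgue_measure)%E.-integrable
    (`[0, 2 * pi]%classic `*` `[0, 2 * pi]%classic : set (R * R))
    (fun t => (modc (f (cis t.1, cis t.2)) `^ a)%:E).

(* The supremum of the empty set is -oo. *)
Definition Lp_sup (f : C * C -> C) : \bar R :=
  ereal_sup [set a%:E | a in [set a : R | 0 < a /\ in_Lp a f]].

Definition ratfun q p (z : C * C) : C := q.[z.1, z.2] / p.[z.1, z.2].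

Definition partial1 (f : C * C -> C) (z : C * C) : C :=
  derive1 (fun w : C => (f (w, z.2) : C^o)) z.1.

Definition integrability_index p (x : \bar R) : Prop :=
  (0 < x)%E /\ exists q, x = Lp_sup (ratfun q p).

(* The element a of R_tau stands for the power series
   \sum_(j, k) a j k * (z1 - tau.1) ^ j * (z2 - tau.2) ^ k. *)
Definition pseries := nat -> nat -> C.

Definition ps_convergent (a : pseries) : Prop :=
  exists2 r : R, 0 < r &
    summable [set: nat * nat]
      (fun m => (modc (a m.1 m.2) * r ^+ (m.1 + m.2))%:E).

Definition ps_mul (a b : pseries) : pseries := fun j k =>
  \sum_(j1 < j.+1) \sum_(k1 < k.+1) a j1 k1 * b (j - j1)%N (k - k1)%N.

Definition taylor tau p : pseries := fun j k =>
  ((map_poly (comp_poly ('X + tau.2%:P)) p \Po ('X + tau.1%:P%:P))`_j)`_k.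

Definition local_ideal tau p q : set pseries :=
  [set a | exists u v : pseries, [/\ ps_convergent u, ps_convergent v &
    forall j k, a j k =
      ps_mul u (taylor tau p) j k + ps_mul v (taylor tau q) j k]].

Definition basis_mod (I : set pseries) n (e : 'I_n -> pseries) : Prop :=
  (forall i, ps_convergent (e i)) /\
  (forall a, ps_convergent a -> exists! c : 'rV[C]_n,
     I (fun j k => a j k - \sum_(i < n) c 0 i * e i j k)).

(* Infimum over a set with at most one element; it is +oo if the quotient
   has infinite dimension. *)
Definition dim_mod (I : set pseries) : \bar R :=
  ereal_inf [set n%:R%:E | n in
    [set n : nat | exists e : 'I_n -> pseries, basis_mod I e]].

Definition intersection_mult p q tau : \bar R :=
  dim_mod (local_ideal tau p q).

Definition common_torus_zeros p q : set (C * C) :=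
  [set tau | [/\ `|tau.1| = 1, `|tau.2| = 1,
     p.[tau.1, tau.2] = 0 & q.[tau.1, tau.2] = 0]].

Definition torus_mult p q : \bar R :=
  \esum_(tau in common_torus_zeros p q) intersection_mult p q tau.

End Defs.

(* Main.v *)
(** Let P = p^2 and p~ = [reversal p]. On the torus |p~| = |p|, so every Q in the
    ideal (P, p p~, p~^2) has Q/P bounded; more generally, if Q lies in this ideal
    locally at every common zero of p and p~ on the torus, then compactness makes
    Q/P bounded, i.e. in L^a for all a. Numerators with distinct finite indices
    are linearly independent modulo such Q, hence the number of finite indices is
    at most the sum over these zeros of dim R_tau / (p, p~)^2, which is at most
    3 dim R_tau / (p, p~): divide by (p, p~), then divide both quotients again.
    Finiteness of the zeros, and of the number of indices even where the
    intersection multiplicity is not known to be finite, comes from nonzero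
    polynomials in z1 alone and in z2 alone contained in (p, p~).
    Finally d/dz1 (q/p) = (q' p - q p') / P, and such quotients lie in some L^a
    with a > 0 because sublevel sets of a nonzero polynomial on the torus have
    polynomially small measure. *)

Require Import Defs.
From mathcomp Require Import fsbigop sequences realfun measurable_realfun.
From mathcomp Require Import numfun ring lra.
Set Implicit Arguments.
Unset Strict Implicit.
Unset Printing Implicit Defensive.
Import Order.TTheory GRing.Theory Num.Theory.
Import numFieldNormedType.Exports.
Local Open Scope classical_set_scope.
Local Open Scope ring_scope.

(** * Bivariate polynomials *)

Section BivariateGcd.
Variable F : closedFieldType.
Implicit Types (g p q u : {poly {poly F}}) (a : {poly F}) (c : F).

(** When [p] is not constant, the multiples of [P] have infinite codimension, so no count can come
    from them alone. The square of the ideal (p, p~) is large enough to have finite codimension, by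
    atorality, and small enough to keep [Q / P] bounded, since each of its three generators has
    modulus |p|^2 on the torus. The factor 3 counts one remainder for [Q] and one for each of its
    two quotients; the 4 of the statement leaves room. The division data are merely chosen for each
    numerator, not linear in it, so codimension is expressed by matrices attached to finite families
    instead of quotient spaces. A separate obstacle is that the supremum over no exponent is -oo,
    which is neither an index nor [+oo]: this is why every numerator must be shown to have some
    positive exponent. *)

Definition evY c g : {poly F} := map_poly (horner_eval c) g.

Lemma evY_eq0 c g : evY c g = 0 -> exists g', g = ('X - c%:P) *: g'.
Proof.
move=> g0; exists (\poly_(i < size g) (g`_i %/ ('X - c%:P))).
apply/polyP => i; rewrite coefZ coef_poly; case: ltnP => [_|lei]; last first.
  by rewrite nth_default// mulr0.
rewrite mulrC divpK// dvdp_XsubCl /root.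
by have := congr1 (fun h : {poly F} => h`_i) g0; rewrite coef_map coef0 => /eqP.
Qed.

(** Over an algebraically closed field a nonconstant content has a root, so primitivity can be
    stated as the nonvanishing of every specialization [evY c]. Each common root is divided out; the
    degree of the leading coefficient drops and bounds the number of steps. *)
Lemma primitive_part g : g != 0 ->
  exists a g0, [/\ a != 0, g = a *: g0 & forall c, evY c g0 != 0].
Proof.
have [n] := ubnP (size (lead_coef g)); elim: n => // n IH in g *.
move=> ltn g0; have [[c gc]|nc] := pselect (exists c, evY c g = 0); last first.
  exists 1, g; split; rewrite ?oner_eq0 ?scale1r// => c; apply/eqP => gc.
  by apply: nc; exists c.
have [g' Dg] := evY_eq0 gc.
have Xc0 : 'X - c%:P != 0 by rewrite polyXsubC_eq0.
have g'0 : g' != 0 by apply: contraNneq g0 => g'0; rewrite Dg g'0 scaler0.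
have [|//|a [g1 [a0 Dg' h]]] := IH g'.
  move: ltn; rewrite Dg lead_coefZ mulrC.
  by rewrite size_Mmonic ?lead_coef_eq0 ?monicXsubC// size_XsubC addn2.
exists (('X - c%:P) * a), g1; split=> //; first by rewrite mulf_neq0.
by rewrite -scalerA -Dg'.
Qed.

(* Gauss' lemma, peeling off one root of [a] at a time. *)
Lemma primitive_dvd a p q g : a != 0 -> (forall c, evY c g != 0) ->
  a *: p = q * g -> exists u, p = u * g.
Proof.
move=> a0 hg; have [n] := ubnP (size a); elim: n => // n IH in a q a0 *.
move=> ltn E; have [sa|sa] := pselect (size a = 1%N).
  have [k k0 Da] := size_poly1P a (introT eqP sa).
  exists ((k^-1)%:P *: q); rewrite -scalerAl -E Da scalerA -polyCM.
  by rewrite mulVf// scale1r.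
have [c] := closed_rootP a (introN eqP sa); rewrite -dvdp_XsubCl => /dvdpP [a' Da].
have Xc0 : 'X - c%:P != 0 by rewrite polyXsubC_eq0.
have a'0 : a' != 0 by apply: contraNneq a0 => h; rewrite Da h mul0r.
(* [evY c] is a morphism into a domain and kills [a], hence [q] or [g]; the hypothesis on [g] leaves
   [q], from which the same linear factor is cancelled. *)
have : evY c (a *: p) = evY c (q * g) by rewrite E.
rewrite -mul_polyC /evY !rmorphM/= map_polyC/= Da /horner_eval hornerM.
rewrite hornerXsubC subrr mulr0 mul0r => /esym/eqP.
rewrite mulf_eq0 (negPf (hg c)) orbF => /eqP /evY_eq0 [q' Dq].
apply: (IH a' q') => //.
  by move: ltn; rewrite Da size_Mmonic ?monicXsubC// size_XsubC addn2.
have Xc0' : ('X - c%:P)%:P != 0 by rewrite polyC_eq0.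
apply: (mulfI Xc0'); rewrite !mul_polyC scalerA mulrC -Da E Dq.
by rewrite scalerAl.
Qed.

(** [gcdp] and its Bezout relation over [{poly F}] hold up to nonzero scalars, as over the fraction
    field. By Gauss' lemma the primitive part of the gcd divides [p] and [q] themselves, so the gcd
    has degree 0 in the outer variable and the Bezout relation eliminates that variable. *)
Lemma coprime_ideal_const p q : p != 0 ->
  (forall d u v, p = u * d -> q = v * d -> (size d <= 1)%N) ->
  exists r u v, r != 0 /\ r%:P = u * p + v * q.
Proof.
move=> p0 cop; pose g := gcdp p q.
have g0 : g != 0 by rewrite gcdp_eq0 negb_and p0.
have [a [g1 [a0 Dg hg1]]] := primitive_part g0.
have dv h : g %| h -> exists u, h = u * g1.
  move=> /Pdiv.Idomain.dvdpP [[c qq] /= c0 E].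
  apply: (@primitive_dvd c h (a *: qq) g1) => //.
  by rewrite E Dg -scalerAr -scalerAl.
have [u Dp] := dv _ (dvdp_gcdl p q); have [v Dq] := dv _ (dvdp_gcdr p q).
have s1 := cop _ _ _ Dp Dq.
have sg : (size g <= 1)%N by rewrite Dg (leq_trans (size_scale_leq _ _)).
have [[u' v']/= /eqpP [[c1 c2] /= /andP[c10 c20] E]] := Bezoutp p q.
exists (c2 * g`_0), (c1 *: u'), (c1 *: v'); split.
  rewrite mulf_neq0//; apply: contraNneq g0 => g00.
  by rewrite (size1_polyC sg) g00.
by rewrite polyCM -(size1_polyC sg) mul_polyC -!scalerAl -scalerDr E.
Qed.

Lemma coprime_ideal_const_both p q : p != 0 ->
  (forall d u v, p = u * d -> q = v * d -> exists c : F, d = c%:P%:P) ->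
  (exists r u v, r != 0 /\ r%:P = u * p + v * q) /\
  (exists r u v, r != 0 /\ map_poly polyC r = u * p + v * q).
Proof.
move=> p0 cop; split.
  apply: coprime_ideal_const => // d u v Dp Dq.
  by have [c ->] := cop _ _ _ Dp Dq; rewrite size_polyC_leq1.
have [||r [u [v [r0 E]]]] := @coprime_ideal_const (swapXY p) (swapXY q).
- by rewrite swapXY_eq0.
- move=> d u v /(congr1 swapXY); rewrite swapXYK rmorphM /= => Dp.
  move=> /(congr1 swapXY); rewrite swapXYK rmorphM /= => Dq.
  have [c /(congr1 swapXY)] := cop _ _ _ Dp Dq.
  by rewrite swapXYK swapXY_polyC map_polyC => ->; rewrite size_polyC_leq1.
exists r, (swapXY u), (swapXY v); split=> //.
by rewrite -swapXY_polyC E rmorphD !rmorphM /= !swapXYK.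
Qed.

End BivariateGcd.

(** * The complex modulus and functions on the torus *)

Section Modulus.
Variable R : realType.
Local Notation C := R[i].
Local Notation modc := (@ComplexField.Normc.normc R).
Implicit Types (z w : C).

Lemma normE z : `|z| = (modc z)%:C%C.
Proof. by case: z => a b; rewrite normc_def. Qed.

Lemma modcE z : modc z = Num.sqrt (complex.Re z ^+ 2 + complex.Im z ^+ 2).
Proof. by case: z. Qed.

Lemma modc_ge0 z : 0 <= modc z.
Proof. by case: z => a b; exact: sqrtr_ge0. Qed.

Lemma modcM z w : modc (z * w) = modc z * modc w.
Proof. exact: ComplexField.Normc.normcM. Qed.

Lemma modcV z : modc z^-1 = (modc z)^-1.
Proof. exact: ComplexField.Normc.normcV. Qed.

Lemma modc0 : modc 0 = 0.
Proof. exact: ComplexField.Normc.normc0. Qed.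

Lemma modc1 : modc 1 = 1.
Proof. exact: ComplexField.Normc.normc1. Qed.

Lemma modcX z n : modc (z ^+ n) = modc z ^+ n.
Proof. by elim: n => [|n IH]; rewrite ?modc1// !exprS modcM IH. Qed.

Lemma modc_eq0 z : (modc z == 0) = (z == 0).
Proof.
apply/eqP/eqP => [|->]; last exact: modc0.
exact: ComplexField.Normc.eq0_normc.
Qed.

Lemma modc_gt0 z : (0 < modc z) = (z != 0).
Proof. by rewrite lt0r modc_ge0 modc_eq0 andbT. Qed.

Lemma modcD z w : modc (z + w) <= modc z + modc w.
Proof. exact: le_normcD. Qed.

Lemma modcN z : modc (- z) = modc z.
Proof. exact: normcN. Qed.

Lemma modcB z w : modc (z - w) <= modc z + modc w.
Proof. by rewrite -(modcN w) modcD. Qed.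

Lemma modc_conj z : modc (z^*)%C = modc z.
Proof. by case: z => a b /=; rewrite sqrrN. Qed.

Lemma modc_sum I (r : seq I) (Q : pred I) (f : I -> C) :
  modc (\sum_(i <- r | Q i) f i) <= \sum_(i <- r | Q i) modc (f i).
Proof.
elim/big_ind2: _ => [|x a y b xa yb|i _]; rewrite ?modc0//.
exact: le_trans (modcD _ _) (lerD xa yb).
Qed.

Lemma modc_prod I (r : seq I) (Q : pred I) (f : I -> C) :
  modc (\prod_(i <- r | Q i) f i) = \prod_(i <- r | Q i) modc (f i).
Proof.
elim/big_ind2: _ => [|x a y b <- <-|i _]; rewrite ?modc1//.
exact: modcM.
Qed.

Lemma norm_eq1 z : `|z| = 1 -> modc z = 1.
Proof. by rewrite normE => -[]. Qed.

Lemma norm_cis t : `|cis t : C| = 1.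
Proof. by rewrite normE modcE/= cos2Dsin2 sqrtr1. Qed.

Lemma modc_cis t : modc (cis t) = 1.
Proof. exact/norm_eq1/norm_cis. Qed.

Lemma conjc_inv_torus z : `|z| = 1 -> ((z^*)%C)^-1 = z.
Proof.
move=> z1; have : z * (z^*)%C = 1 by rewrite -sqr_normc z1 expr1n.
move=> e; have z0 : z != 0 by rewrite -normr_eq0 z1 oner_eq0.
by rewrite -[(z^*)%C](mulKf z0) e mulr1 invrK.
Qed.

(** On the torus the inverse of the conjugate of [z] is [z], so the reversal is a unimodular
    monomial times the conjugate of [p]. *)
Lemma modc_reversal_torus (p : {poly {poly C}}) z w :
  `|z| = 1 -> `|w| = 1 -> modc (reversal p).[z, w] = modc p.[z, w].
Proof.
move=> z1 w1.
have nz (u : C) : `|u| = 1 -> u != 0 by move=> h; rewrite -normr_eq0 h oner_eq0.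
rewrite horner_reversal ?nz// !modcM !modcX (norm_eq1 z1) (norm_eq1 w1) !expr1n !mul1r.
by rewrite modc_conj !conjc_inv_torus.
Qed.

End Modulus.

Section FunctionAlgebra.
Variables (R : realType) (T : Type) (S : (T -> R) -> Prop).
Local Notation C := R[i].
Hypotheses (Scst : forall c : R, S (fun=> c))
  (SD : forall f g, S f -> S g -> S (fun t => f t + g t))
  (SM : forall f g, S f -> S g -> S (fun t => f t * g t)).

(** Continuity and measurability of polynomials along [cis] both follow from closure of a class of
    real functions under constants, sums and products; [S] is instantiated with each of them. *)
Definition re_im_in (f : T -> C) :=
  S (fun t => complex.Re (f t)) /\ S (fun t => complex.Im (f t)).

Lemma re_im_in_cst (c : C) : re_im_in (fun=> c).
Proof. by split; exact: Scst. Qed.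

Lemma re_im_inD f g : re_im_in f -> re_im_in g -> re_im_in (fun t => f t + g t).
Proof.
move=> [f1 f2] [g1 g2]; split.
  rewrite (_ : (fun t => _) = fun t => complex.Re (f t) + complex.Re (g t)).
    exact: SD.
  by apply/funext => t; case: (f t) (g t) => a b [].
rewrite (_ : (fun t => _) = fun t => complex.Im (f t) + complex.Im (g t)).
  exact: SD.
by apply/funext => t; case: (f t) (g t) => a b [].
Qed.

Lemma re_im_inM f g : re_im_in f -> re_im_in g -> re_im_in (fun t => f t * g t).
Proof.
move=> [f1 f2] [g1 g2]; split.
  rewrite (_ : (fun t => _) = fun t => complex.Re (f t) * complex.Re (g t) +
      -1 * (complex.Im (f t) * complex.Im (g t))).
    by apply: SD; [exact: SM|apply: SM; [exact: Scst|exact: SM]].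
  by apply/funext => t; case: (f t) (g t) => a b [] c d/=; rewrite mulN1r.
rewrite (_ : (fun t => _) = fun t => complex.Re (f t) * complex.Im (g t) +
    complex.Im (f t) * complex.Re (g t)).
  by apply: SD; exact: SM.
by apply/funext => t; case: (f t) (g t) => a b [].
Qed.

Lemma re_im_in_horner (f : T -> C) (p : {poly C}) :
  re_im_in f -> re_im_in (fun t => p.[f t]).
Proof.
move=> Sf; elim/poly_ind: p => [|p c IH].
  rewrite (_ : (fun t => _) = fun=> 0); first exact: re_im_in_cst.
  by apply/funext => t; rewrite horner0.
rewrite (_ : (fun t => _) = fun t => p.[f t] * f t + c); last first.
  by apply/funext => t; rewrite !hornerE.
by apply: re_im_inD; [exact: re_im_inM|exact: re_im_in_cst].
Qed.

Lemma re_im_in_horner2 (f g : T -> C) (p : {poly {poly C}}) :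
  re_im_in f -> re_im_in g -> re_im_in (fun t => p.[f t, g t]).
Proof.
move=> Sf Sg; elim/poly_ind: p => [|p c IH].
  rewrite (_ : (fun t => _) = fun=> 0); first exact: re_im_in_cst.
  by apply/funext => t; rewrite !horner0.
rewrite (_ : (fun t => _) = fun t => p.[f t, g t] * f t + c.[g t]); last first.
  by apply/funext => t; rewrite !hornerE.
by apply: re_im_inD; [exact: re_im_inM|exact: re_im_in_horner].
Qed.

End FunctionAlgebra.

Section TorusFunctions.
Variable R : realType.
Local Notation C := R[i].
Local Notation modc := (@ComplexField.Normc.normc R).
Implicit Types (p : {poly {poly C}}).

Definition angles : set (R * R) := `[0, 2 * pi] `*` `[0, 2 * pi].

Definition torus_eval p (t : R * R) : C := p.[cis t.1, cis t.2].

Lemma compact_angles : compact angles.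
Proof. by apply: compact_setX; exact: segment_compact. Qed.

Lemma measurable_angles : measurable angles.
Proof. by apply: measurableX; exact: measurable_itv. Qed.

Lemma continuous_modc_torus p : continuous (fun t => modc (torus_eval p t)).
Proof.
pose S (f : R * R -> R) := continuous f.
have Sc (c : R) : S (fun=> c) by move=> t; exact: cvg_cst.
have SD f g : S f -> S g -> S (fun t => f t + g t).
  by move=> Sf Sg t; apply: cvgD; [exact: Sf|exact: Sg].
have SM f g : S f -> S g -> S (fun t => f t * g t).
  by move=> Sf Sg t; apply: cvgM; [exact: Sf|exact: Sg].
have S1 : re_im_in S (fun t => cis t.1).
  split=> t /=; apply: continuous_comp; try exact: cvg_fst.
    exact: continuous_cos.
  exact: continuous_sin.
have S2 : re_im_in S (fun t => cis t.2).
  split=> t /=; apply: continuous_comp; try exact: cvg_snd.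
    exact: continuous_cos.
  exact: continuous_sin.
have [h1 h2] := re_im_in_horner2 Sc SD SM p S1 S2.
rewrite (_ : (fun t => _) = fun t => Num.sqrt (complex.Re (torus_eval p t) ^+ 2 +
  complex.Im (torus_eval p t) ^+ 2)); last by apply/funext => t; rewrite modcE.
have hh f : S f -> S (fun t => f t ^+ 2).
  by move=> Sf s; apply: (SM f f Sf Sf).
have h3 := SD _ _ (hh _ h1) (hh _ h2).
by move=> t; exact: (continuous_comp (h3 t) (@sqrt_continuous _ _)).
Qed.

Lemma measurable_modc_torus p : measurable_fun setT (fun t => modc (torus_eval p t)).
Proof.
pose S (f : R * R -> R) := measurable_fun setT f.
have Sc (c : R) : S (fun=> c) by exact: measurable_cst.
have SD f g : S f -> S g -> S (fun t => f t + g t) by exact: measurable_funD.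
have SM f g : S f -> S g -> S (fun t => f t * g t) by exact: measurable_funM.
have mcos : measurable_fun setT (@cos R).
  by apply: continuous_measurable_fun; exact: continuous_cos.
have msin : measurable_fun setT (@sin R).
  by apply: continuous_measurable_fun; exact: continuous_sin.
have S1 : re_im_in S (fun t => cis t.1).
  by split; rewrite /S/=; apply: measurableT_comp => //; exact: measurable_fst.
have S2 : re_im_in S (fun t => cis t.2).
  by split; rewrite /S/=; apply: measurableT_comp => //; exact: measurable_snd.
have [h1 h2] := re_im_in_horner2 Sc SD SM p S1 S2.
rewrite (_ : (fun t => _) = fun t => Num.sqrt (complex.Re (torus_eval p t) ^+ 2 +
  complex.Im (torus_eval p t) ^+ 2)); last by apply/funext => t; rewrite modcE.
apply: (@measurableT_comp _ _ _ _ _ _ (@Num.sqrt R)).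
  by apply: continuous_measurable_fun; exact: sqrt_continuous.
by apply: SD; exact: measurable_funX.
Qed.

Lemma torus_eval_bounded p : exists2 B, 0 < B & forall t, modc (torus_eval p t) <= B.
Proof.
have h1 (q : {poly C}) : exists2 B, 0 < B & forall t, modc q.[cis t] <= B.
  elim/poly_ind: q => [|q c [B B0 h]].
    by exists 1 => // t; rewrite horner0 modc0.
  exists (B + modc c) => [|t]; first by rewrite ltr_wpDr// modc_ge0.
  rewrite !hornerE; apply: le_trans (modcD _ _) _.
  by rewrite lerD2r modcM modc_cis mulr1.
elim/poly_ind: p => [|p c [B B0 h]].
  by exists 1 => // t; rewrite /torus_eval !horner0 modc0.
have [B' B'0 h'] := h1 c.
exists (B + B') => [|t]; first exact: addr_gt0.
rewrite /torus_eval !hornerE; apply: le_trans (modcD _ _) _.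
by rewrite lerD// modcM modc_cis mulr1; exact: h.
Qed.

Lemma torus_evalM p q t : torus_eval (p * q) t = torus_eval p t * torus_eval q t.
Proof. by rewrite /torus_eval !hornerM. Qed.

End TorusFunctions.

(** * Truncated power series *)

Section TruncatedSeries.
Variable R : realType.
Local Notation C := R[i].
Local Notation modc := (@ComplexField.Normc.normc R).
Implicit Types (a b : pseries R) (x y : C) (p q : {poly {poly C}}) (tau : C * C).

Definition rect_sum m l a x y : C :=
  \sum_(j < m) \sum_(k < l) a j k * (x ^+ j * y ^+ k).

(** Cauchy-type estimate, the form in which convergence enters the bounds: for arguments of modulus
    at most [r / 2] it gives a geometric majorant of ratio 1/2 in each variable. *)
Definition coef_le (K r : R) a := forall j k, modc (a j k) * r ^+ (j + k) <= K.

Lemma ps_convergent_coef_le a : ps_convergent a ->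
  exists K r, [/\ 0 <= K, 0 < r & coef_le K r a].
Proof.
move=> [r r0]; rewrite summableE.
set s := (X in X \is a fin_num) => sfin.
have le1 (m : nat * nat) : ((modc (a m.1 m.2) * r ^+ (m.1 + m.2))%:E <= s)%E.
  apply: esum_ge; exists [set m]; first by split => //; exact: finite_set1.
  by rewrite fsbig_set1 lee_fin ler_norm.
exists (fine s), r; split=> // [|j k].
  by rewrite fine_ge0//; apply: esum_ge0 => *; exact: abse_ge0.
by have := le1 (j, k); rewrite -[s in X in X -> _]fineK// lee_fin.
Qed.

Lemma coef_le_shrink K r s a : 0 <= s -> s <= r -> coef_le K r a -> coef_le K s a.
Proof.
move=> s0 sr h j k; apply: le_trans (h j k).
by rewrite ler_wpM2l ?modc_ge0// lerXn2r// nnegrE// (le_trans s0).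
Qed.

Lemma finite_ps_convergent a d :
  (forall j k, ~~ ((j < d) && (k < d))%N -> a j k = 0) -> ps_convergent a.
Proof.
move=> h; exists 1 => //; rewrite /summable.
set f := (fun m : nat * nat => _).
have -> : \esum_(m in [set: nat * nat]) f m = \esum_(m in `I_d `*` `I_d) f m.
  rewrite [RHS]esum_mkcond; apply: eq_esum => -[j k] _.
  case: ifPn => //; rewrite notin_setE/= => nd.
  rewrite /f/= h; first by rewrite modc0 mul0r normr0.
  by apply/negP => /andP[jd kd]; apply: nd.
have fin : finite_set (`I_d `*` `I_d) by exact: finite_setX.
rewrite esum_fset// => [|i _]; last exact: abse_ge0.
by rewrite /f fsumEFin// ltry.
Qed.

Definition half_sum n : R := \sum_(j < n) 2^-1 ^+ j.

Lemma half_sumE n : half_sum n = 2 - 2 * 2^-1 ^+ n.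
Proof.
rewrite /half_sum; elim: n => [|n IH]; first by rewrite big_ord0 expr0; lra.
by rewrite big_ord_recr/= IH exprS; lra.
Qed.

Lemma half_sum_ge0 n : 0 <= half_sum n.
Proof. by apply: sumr_ge0 => i _; rewrite exprn_ge0. Qed.

Lemma half_sum_le2 n : half_sum n <= 2.
Proof.
have : 0 <= (2^-1 : R) ^+ n by rewrite exprn_ge0.
by rewrite half_sumE; lra.
Qed.

Lemma coef_le_term K r a x y j k : 0 < r -> coef_le K r a ->
  modc x <= r / 2 -> modc y <= r / 2 ->
  modc (a j k * (x ^+ j * y ^+ k)) <= K * (2^-1 ^+ j * 2^-1 ^+ k).
Proof.
move=> r0 h xr yr; rewrite !modcM !modcX.
have e (u : C) i : modc u <= r / 2 -> modc u ^+ i <= r ^+ i * 2^-1 ^+ i.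
  by move=> ur; rewrite -exprMn lerXn2r// ?nnegrE ?modc_ge0// divr_ge0// ltW.
apply: le_trans (_ : modc (a j k) * ((r ^+ j * 2^-1 ^+ j) * (r ^+ k * 2^-1 ^+ k)) <= _).
  by rewrite ler_wpM2l ?modc_ge0// ler_pM ?e// exprn_ge0// modc_ge0.
by rewrite mulrACA [leLHS]mulrA ler_wpM2r ?mulr_ge0 ?exprn_ge0// -exprD h.
Qed.

(** Rectangles of different sizes become sums over one common square, so that their differences can
    be bounded term by term. *)
Lemma rect_sum_mask n m l a x y : (m <= n)%N -> (l <= n)%N ->
  rect_sum m l a x y = \sum_(j < n) \sum_(k < n)
    if ((j < m) && (k < l))%N then a j k * (x ^+ j * y ^+ k) else 0.
Proof.
move=> mn ln; rewrite /rect_sum.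
rewrite (big_ord_widen n (fun j => \sum_(k < l) a j k * (x ^+ j * y ^+ k)))//.
rewrite big_mkcond; apply: eq_bigr => j _; case: ifP => /= jm; last first.
  by rewrite big1.
rewrite (big_ord_widen n (fun k => a j k * (x ^+ j * y ^+ k)))//.
by rewrite big_mkcond.
Qed.

Lemma half_sum_mask n m l : (m <= n)%N -> (l <= n)%N ->
  half_sum m * half_sum l = \sum_(j < n) \sum_(k < n)
    if ((j < m) && (k < l))%N then 2^-1 ^+ j * 2^-1 ^+ k else 0.
Proof.
move=> mn ln; rewrite /half_sum mulr_suml.
rewrite (big_ord_widen n (fun j => 2^-1 ^+ j * \sum_(k < l) 2^-1 ^+ k))//.
rewrite big_mkcond; apply: eq_bigr => j _; case: ifP => /= jm; last first.
  by rewrite big1.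
rewrite mulr_sumr (big_ord_widen n (fun k => 2^-1 ^+ j * 2^-1 ^+ k))//.
by rewrite big_mkcond.
Qed.

(** Only the terms of the square outside the rectangle survive; the right-hand side is the sum of
    their geometric majorants. *)
Lemma rect_sum_diff K r a x y n m l : 0 <= K -> 0 < r -> coef_le K r a ->
  modc x <= r / 2 -> modc y <= r / 2 -> (m <= n)%N -> (l <= n)%N ->
  modc (rect_sum m l a x y - rect_sum n n a x y) <=
    K * (half_sum n * half_sum n - half_sum m * half_sum l).
Proof.
move=> K0 r0 h xr yr mn ln.
rewrite !(@rect_sum_mask n)// (@half_sum_mask n n n)// (@half_sum_mask n m l)//.
rewrite -!sumrB mulr_sumr; apply: le_trans (modc_sum _ _ _) _.
apply: ler_sum => j _; rewrite -!sumrB mulr_sumr.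
apply: le_trans (modc_sum _ _ _) _; apply: ler_sum => k _.
rewrite !ltn_ord/=; case: ifP => _; first by rewrite !subrr modc0 mulr0.
by rewrite sub0r subr0 modcN; exact: coef_le_term yr.
Qed.

Lemma rect_sum_le K r a x y n : 0 <= K -> 0 < r -> coef_le K r a ->
  modc x <= r / 2 -> modc y <= r / 2 -> modc (rect_sum n n a x y) <= K * 4.
Proof.
move=> K0 r0 h xr yr.
have := @rect_sum_diff K r a x y n 0 0 K0 r0 h xr yr (leq0n _) (leq0n _).
rewrite {1}/rect_sum !big_ord0 sub0r modcN => /le_trans; apply.
rewrite ler_wpM2l// /half_sum !big_ord0 mul0r subr0.
have := half_sum_ge0 n; have := half_sum_le2 n; rewrite /half_sum; nra.
Qed.

Lemma triangle_sum (V : nmodType) n (f : nat -> nat -> V) :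
  \sum_(j < n) \sum_(i < j.+1) f i (j - i)%N =
  \sum_(s < n) \sum_(i < n - s) f i s.
Proof.
elim: n => [|n IH]; first by rewrite !big_ord0.
rewrite big_ord_recr/= IH.
have -> : \sum_(s < n.+1) \sum_(i < n.+1 - s) f i s =
    \sum_(s < n.+1) (\sum_(i < n - s) f i s + f (n - s)%N s).
  apply: eq_bigr => s _; rewrite subSn ?big_ord_recr//.
  by rewrite -ltnS ltn_ord.
rewrite big_split/= [X in _ = X + _]big_ord_recr/= subnn big_ord0 addr0.
congr (_ + _).
rewrite [RHS](reindex_inj rev_ord_inj); apply: eq_bigr => i _ /=.
by rewrite subSS subKn// -ltnS ltn_ord.
Qed.

(** Cauchy product grouped by the coefficients of [b]: the term of index (s, t) meets a truncation
    of [a] shortened by s and t, which is what separates this sum from the product of the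
    truncations. *)
Lemma rect_sum_mul n a b x y :
  rect_sum n n (ps_mul a b) x y = \sum_(s < n) \sum_(t < n)
    (b s t * (x ^+ s * y ^+ t)) * rect_sum (n - s) (n - t) a x y.
Proof.
transitivity (\sum_(j < n) \sum_(j1 < j.+1) \sum_(k < n) \sum_(k1 < k.+1)
   (a j1 k1 * b (j - j1)%N (k - k1)%N *
     (x ^+ j1 * x ^+ (j - j1) * (y ^+ k1 * y ^+ (k - k1))))).
  apply: eq_bigr => j _; rewrite exchange_big/=; apply: eq_bigr => k _.
  rewrite /ps_mul mulr_suml; apply: eq_bigr => j1 _.
  rewrite mulr_suml; apply: eq_bigr => k1 _.
  by rewrite -!exprD !subnKC// -ltnS ltn_ord.
rewrite (@triangle_sum _ n (fun j1 j2 => \sum_(k < n) \sum_(k1 < k.+1)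
   (a j1 k1 * b j2 (k - k1)%N * (x ^+ j1 * x ^+ j2 * (y ^+ k1 * y ^+ (k - k1)))))).
apply: eq_bigr => s _.
under eq_bigr => j1 _ do rewrite (@triangle_sum _ n (fun k1 k2 =>
  a j1 k1 * b s k2 * (x ^+ j1 * x ^+ s * (y ^+ k1 * y ^+ k2)))).
rewrite exchange_big/=; apply: eq_bigr => t _.
rewrite /rect_sum mulr_sumr; apply: eq_bigr => j1 _.
by rewrite mulr_sumr; apply: eq_bigr => k1 _; ring.
Qed.

Lemma half_power_small (M e : R) d : 0 < e ->
  \forall n \near \oo, M * 2^-1 ^+ (n - d) <= e.
Proof.
move=> e0; have [|M0] := leP M 0.
  by move=> M0; near=> n; rewrite (le_trans _ (ltW e0))// mulr_le0_ge0// exprn_ge0.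
exists (d + Num.bound (M / e))%N => // n /= dn.
have h : M / e < (n - d)%:R.
  apply: lt_le_trans (archi_boundP _) _; first by rewrite divr_ge0// ltW.
  by rewrite ler_nat leq_subRL// (leq_trans (leq_addr _ _) dn).
rewrite exprVn ler_pdivrMr ?exprn_gt0//.
rewrite ltr_pdivrMr// mulrC in h; apply: le_trans (ltW h) _.
by rewrite ler_pM2l// -natrX ler_nat ltnW// ltn_expl.
Unshelve. all: by end_near. Qed.

(** As [b] is supported in the square of side [d], only truncations of [a] of side at least [n - d]
    occur, and each differs from the full one by O(2^-(n-d)). *)
Lemma rect_sum_mul_near K L r a b d x y :
  0 <= K -> 0 <= L -> 0 < r -> coef_le K r a -> coef_le L r b ->
  (forall j k, ~~ ((j < d) && (k < d))%N -> b j k = 0) ->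
  modc x <= r / 2 -> modc y <= r / 2 -> forall e, 0 < e ->
  \forall n \near \oo, modc (rect_sum n n (ps_mul a b) x y -
    rect_sum n n b x y * rect_sum n n a x y) <= e.
Proof.
move=> K0 L0 r0 ha hb hd xr yr e e0; near=> n.
rewrite rect_sum_mul {2}/rect_sum mulr_suml -sumrB.
apply: le_trans (modc_sum _ _ _) _.
have dn : (d <= n)%N by near: n; exact: nbhs_infty_ge.
(* With w = 2^-(n-d), half sums of length at least n - d lie between 2 - 2w and 2, so a difference
   of products is at most 4 - (2 - 2w)^2 <= 8w. Summing the majorants of [b] costs another factor 4,
   whence the 32 below. *)
apply: le_trans (_ : \sum_(s < n) \sum_(t < n)
    L * (2^-1 ^+ s * 2^-1 ^+ t) * (K * (8 * 2^-1 ^+ (n - d))) <= _).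
  apply: ler_sum => s _; rewrite mulr_suml -sumrB.
  apply: le_trans (modc_sum _ _ _) _; apply: ler_sum => t _.
  rewrite -mulrBr modcM.
  have [/andP[sd td]|nd] := boolP ((s < d) && (t < d))%N; last first.
    rewrite hd// mul0r modc0 mul0r !mulr_ge0//; exact: exprn_ge0.
  apply: ler_pM; rewrite ?modc_ge0//; first exact: coef_le_term xr yr.
  apply: le_trans (rect_sum_diff K0 r0 ha xr yr (leq_subr _ _) (leq_subr _ _)) _.
  rewrite ler_wpM2l//.
  have H m : (n - d <= m)%N -> (m <= n)%N ->
      2 - 2 * 2^-1 ^+ (n - d) <= half_sum m.
    move=> dm mn; rewrite half_sumE lerD2l lerN2 ler_wpM2l//.
    by rewrite ler_wiXn2l// invf_le1// ler1n.
  have Hs := H (n - s)%N (leq_sub2l _ (ltnW sd)) (leq_subr _ _).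
  have Ht := H (n - t)%N (leq_sub2l _ (ltnW td)) (leq_subr _ _).
  have Pn : 0 <= (2^-1 : R) ^+ (n - d) by rewrite exprn_ge0.
  have Pn1 : (2^-1 : R) ^+ (n - d) <= 1 by rewrite exprn_ile1// invf_le1// ler1n.
  have := half_sum_le2 n; have := half_sum_ge0 n.
  move: Hs Ht Pn Pn1; set w := 2^-1 ^+ (n - d); set u := half_sum (n - s).
  set v := half_sum (n - t); set g := half_sum n => *.
  have : g * g <= 4 by nra.
  have : (2 - 2 * w) * (2 - 2 * w) <= u * v by apply: ler_pM => //; lra.
  nra.
have -> : \sum_(s < n) \sum_(t < n)
    L * (2^-1 ^+ s * 2^-1 ^+ t) * (K * (8 * 2^-1 ^+ (n - d))) =
   (L * K * 8 * (half_sum n * half_sum n)) * 2^-1 ^+ (n - d).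
  rewrite {1}/half_sum !mulr_suml mulr_sumr mulr_suml; apply: eq_bigr => s _.
  rewrite /half_sum !mulr_sumr mulr_suml; apply: eq_bigr => t _; ring.
apply: le_trans (_ : (L * K * 32) * 2^-1 ^+ (n - d) <= _).
  rewrite ler_wpM2r ?exprn_ge0// -mulrA ler_wpM2l ?mulr_ge0//.
  have := half_sum_ge0 n; have := half_sum_le2 n; nra.
by near: n; exact: half_power_small.
Unshelve. all: by end_near. Qed.

Lemma rect_sumD n a b x y :
  rect_sum n n (fun j k => a j k + b j k) x y =
  rect_sum n n a x y + rect_sum n n b x y.
Proof.
rewrite /rect_sum -big_split/=; apply: eq_bigr => j _.
by rewrite -big_split/=; apply: eq_bigr => k _; rewrite mulrDl.
Qed.

Lemma rect_sum_lin n m (c : 'I_m -> C) (e : 'I_m -> pseries R) x y :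
  rect_sum n n (fun j k => \sum_(i < m) c i * e i j k) x y =
  \sum_(i < m) c i * rect_sum n n (e i) x y.
Proof.
rewrite /rect_sum; under [RHS]eq_bigr => i _ do rewrite mulr_sumr.
rewrite [RHS]exchange_big/=; apply: eq_bigr => j _.
under [RHS]eq_bigr => i _ do rewrite mulr_sumr.
rewrite [RHS]exchange_big/=; apply: eq_bigr => k _.
by rewrite mulr_suml; apply: eq_bigr => i _; rewrite -mulrA.
Qed.

Lemma taylor_finite tau p :
  exists d, forall j k, ~~ ((j < d) && (k < d))%N -> taylor tau p j k = 0.
Proof.
rewrite /taylor; set P := (_ \Po _).
exists (maxn (size P) (sizeY P)) => j k; rewrite negb_and -!leqNgt.
move=> /orP[jd|kd].
  have /leq_sizeP/(_ _ (leqnn j)) -> := leq_trans (leq_maxl _ _) jd.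
  by rewrite coef0.
rewrite nth_default//; apply: leq_trans (max_size_coefXY _ _) _.
exact: leq_trans (leq_maxr _ _) kd.
Qed.

Lemma ps_convergent_taylor tau p : ps_convergent (taylor tau p).
Proof. by have [d /finite_ps_convergent] := taylor_finite tau p. Qed.

Lemma rect_sum_taylor tau p :
  \forall n \near \oo, forall z1 z2,
    rect_sum n n (taylor tau p) (z1 - tau.1) (z2 - tau.2) = p.[z1, z2].
Proof.
rewrite /taylor; set P := (_ \Po _).
have PE z1 z2 : P.[z1 - tau.1, z2 - tau.2] = p.[z1, z2].
  rewrite /P horner_comp !hornerE -polyCD subrK.
  rewrite -{1}(comp_polyC z1 ('X + tau.2%:P)) horner_map/= horner_comp.
  by rewrite !hornerE subrK.
exists (maxn (size P) (sizeY P)) => // n /=; rewrite geq_max => /andP[s1 s2] z1 z2.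
rewrite -PE (horner_coef_wide _ s1) horner_sum; apply: eq_bigr => j _.
rewrite -polyC_exp hornerM hornerC.
rewrite (@horner_coef_wide _ n); last exact: leq_trans (max_size_coefXY _ _) s2.
by rewrite mulr_suml; apply: eq_bigr => k _; ring.
Qed.

End TruncatedSeries.

(** * Codimension of spaces of polynomials *)

Section FiniteCodimension.
Variable R : realType.
Local Notation C := R[i].
Local Notation BP := {poly {poly C}}.

(* Finite-family form of: [S] contains a subspace of codimension at most [D]. *)
Definition fincodim (D : nat) (S : BP -> Prop) :=
  forall m (Q : 'I_m -> BP), exists A : 'M[C]_(m, D),
    forall x : 'rV_m, x *m A = 0 -> S (\sum_i (x 0 i)%:P%:P * Q i).

Lemma fincodim_setI D1 D2 (S1 S2 : BP -> Prop) :
  fincodim D1 S1 -> fincodim D2 S2 ->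
  fincodim (D1 + D2) (fun q => S1 q /\ S2 q).
Proof.
move=> h1 h2 m Q; have [A1 H1] := h1 m Q; have [A2 H2] := h2 m Q.
exists (row_mx A1 A2) => x; rewrite mul_mx_row -[0]row_mx0.
by move=> /eq_row_mx[/H1 ? /H2].
Qed.

Lemma fincodim_seq (I : eqType) (s : seq I) (d : I -> nat) (S : I -> BP -> Prop) :
  (forall i, i \in s -> fincodim (d i) (S i)) ->
  fincodim (\sum_(i <- s) d i) (fun q => forall i, i \in s -> S i q).
Proof.
elim: s => [|i s IH] h.
  by rewrite big_nil => m Q; exists 0 => x _ i; rewrite in_nil.
rewrite big_cons => m Q.
have [|A hA] := fincodim_setI (h i (mem_head _ _)) (IH _) Q.
  by move=> j js; apply: h; rewrite in_cons js orbT.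
exists A => x /hA[Si Ss] j; rewrite in_cons => /orP[/eqP->//|].
exact: Ss.
Qed.

Lemma fincodim_dependent D (S : BP -> Prop) m (Q : 'I_m -> BP) :
  fincodim D S -> (D < m)%N ->
  exists2 x : 'rV[C]_m, x != 0 & S (\sum_i (x 0 i)%:P%:P * Q i).
Proof.
move=> h Dm; have [A hA] := h m Q.
have : kermx A != 0.
  rewrite kermx_eq0 /row_free; apply/negP => /eqP rk.
  by have := rank_leq_col A; rewrite rk leqNgt Dm.
case/rowV0Pn => x /sub_kermxP xA x0.
by exists x => //; exact: hA.
Qed.

End FiniteCodimension.

(** * Numerators dominated by |p|^2 near one point of the torus *)

Section LocalCodimension.
Variables (R : realType).
Local Notation C := R[i].
Local Notation BP := {poly {poly C}}.
Local Notation modc := (@ComplexField.Normc.normc R).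
Variables (p : BP) (tau : C * C).
Implicit Types (g h : nat -> C -> C -> C) (k n : nat).

(* A sequence of functions that is O(|p|^k) near [tau] on the torus, up to an
   error tending pointwise to 0. Truncating power series instead of summing
   them makes completeness of the complex numbers unnecessary. *)
Definition near_le k g := exists B r, 0 < r /\
  forall z1 z2, `|z1| = 1 -> `|z2| = 1 ->
    modc (z1 - tau.1) <= r -> modc (z2 - tau.2) <= r -> forall e, 0 < e ->
    \forall n \near \oo, modc (g n z1 z2) <= B * modc p.[z1, z2] ^+ k + e.

Lemma near_leD k g h : near_le k g -> near_le k h ->
  near_le k (fun n z1 z2 => g n z1 z2 + h n z1 z2).
Proof.
move=> [B [r [r0 hg]]] [B' [r' [r'0 hh]]].
exists (B + B'), (Num.min r r'); split; first by rewrite lt_min r0.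
move=> z1 z2 t1 t2; rewrite !le_min => /andP[a1 b1] /andP[a2 b2] e e0.
have e20 : 0 < e / 2 by rewrite divr_gt0.
have := hg z1 z2 t1 t2 a1 a2 _ e20; have := hh z1 z2 t1 t2 b1 b2 _ e20.
apply: filterS2 => n hn gn.
by apply: le_trans (modcD _ _) _; rewrite mulrDl; lra.
Qed.

(** Stated for any [f] with the modulus of [p], so that multiplication by [p] and by its reversal
    both raise the exponent. *)
Lemma near_leM k g (f : C -> C -> C) :
  (forall z1 z2, `|z1| = 1 -> `|z2| = 1 -> modc (f z1 z2) = modc p.[z1, z2]) ->
  near_le k g -> near_le k.+1 (fun n z1 z2 => f z1 z2 * g n z1 z2).
Proof.
move=> hf [B [r [r0 hg]]]; exists B, r; split=> // z1 z2 t1 t2 a1 a2 e e0.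
have m0 := modc_ge0 p.[z1, z2].
(* The error only has to tend to 0 pointwise, so it may be divided by a quantity depending on the
   point; adding 1 avoids a division by 0 at the zeros of [p]. *)
have m10 : 0 < modc p.[z1, z2] + 1 by rewrite ltr_wpDl.
have := hg z1 z2 t1 t2 a1 a2 _ (divr_gt0 e0 m10); apply: filterS => n hn.
rewrite modcM hf// exprS; apply: le_trans (ler_wpM2l m0 hn) _.
rewrite mulrDr mulrCA lerD2l mulrCA ler_piMr ?ltW// ltr_pdivrMr// mul1r.
by rewrite ltrDl.
Qed.

Lemma near_leZ k g (c : C) : near_le k g ->
  near_le k (fun n z1 z2 => c * g n z1 z2).
Proof.
move=> [B [r [r0 hg]]]; exists (modc c * B), r; split=> // z1 z2 t1 t2 a1 a2 e e0.
have m0 := modc_ge0 c; have m10 : 0 < modc c + 1 by rewrite ltr_wpDl.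
have := hg z1 z2 t1 t2 a1 a2 _ (divr_gt0 e0 m10); apply: filterS => n hn.
rewrite modcM; apply: le_trans (ler_wpM2l m0 hn) _.
rewrite mulrDr [modc c * (B * _)]mulrA lerD2l mulrCA ler_piMr ?ltW//.
by rewrite ltr_pdivrMr// mul1r ltrDl.
Qed.

Lemma near_le0 k : near_le k (fun _ _ _ => 0).
Proof.
exists 0, 1; split=> // z1 z2 _ _ _ _ e e0.
by near=> n; rewrite modc0 mul0r add0r ltW.
Unshelve. all: by end_near. Qed.

Lemma near_le_sum k m (g : 'I_m -> nat -> C -> C -> C) :
  (forall i, near_le k (g i)) ->
  near_le k (fun n z1 z2 => \sum_i g i n z1 z2).
Proof.
elim: m g => [|m IH] g hg.
  rewrite (_ : (fun n z1 z2 => _) = fun _ _ _ => 0); first exact: near_le0.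
  by apply/funext => n; apply/funext => z1; apply/funext => z2; rewrite big_ord0.
rewrite (_ : (fun n z1 z2 => _) = fun n z1 z2 =>
  g ord0 n z1 z2 + \sum_i g (lift ord0 i) n z1 z2).
  by apply: near_leD => //; exact: IH.
by apply/funext => n; apply/funext => z1; apply/funext => z2; rewrite big_ord_recl.
Qed.

Definition series_fun (a : pseries R) n (z1 z2 : C) : C :=
  rect_sum n n a (z1 - tau.1) (z2 - tau.2).

Lemma near_le_series a : ps_convergent a -> near_le 0 (series_fun a).
Proof.
move=> /ps_convergent_coef_le[K [r [K0 r0 ha]]].
exists (K * 4), (r / 2); split; first by rewrite divr_gt0.
move=> z1 z2 _ _ a1 a2 e e0; near=> n; rewrite expr0 mulr1.
apply: le_trans (rect_sum_le _ K0 r0 ha a1 a2) _.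
by rewrite lerDl ltW.
Unshelve. all: by end_near. Qed.

(** The difference is a pure truncation error tending to 0, so the constant is [B = 0] and the
    exponent [k] is arbitrary. *)
Lemma near_le_mul_taylor k a (q : BP) : ps_convergent a ->
  near_le k (fun n z1 z2 => series_fun (ps_mul a (taylor tau q)) n z1 z2 -
    q.[z1, z2] * series_fun a n z1 z2).
Proof.
move=> /ps_convergent_coef_le[K [r [K0 r0 ha]]].
have /ps_convergent_coef_le[L [s [L0 s0 hb]]] := ps_convergent_taylor tau q.
have [d hd] := taylor_finite tau q.
pose u := Num.min r s.
have u0 : 0 < u by rewrite lt_min r0.
have {}ha : coef_le K u a by apply: coef_le_shrink ha; [exact: ltW|rewrite ge_min lexx].
have {}hb : coef_le L u (taylor tau q).
  by apply: coef_le_shrink hb; [exact: ltW|rewrite ge_min lexx orbT].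
exists 0, (u / 2); split; first by rewrite divr_gt0.
move=> z1 z2 _ _ a1 a2 e e0.
have h1 := rect_sum_mul_near K0 L0 u0 ha hb hd a1 a2 e0.
have := rect_sum_taylor tau q; apply: filterS2 h1 => n h1 h2.
by rewrite mul0r add0r /series_fun -(h2 z1 z2).
Qed.

Lemma near_le_poly k (q : BP) :
  near_le k (fun n z1 z2 => q.[z1, z2] - series_fun (taylor tau q) n z1 z2).
Proof.
exists 0, 1; split=> // z1 z2 _ _ _ _ e e0.
have := rect_sum_taylor tau q; apply: filterS => n h.
by rewrite /series_fun h subrr modc0 mul0r add0r ltW.
Qed.

(** The identity between coefficients is exact; evaluating the two products costs only truncation
    errors, hence the validity for every [k]. *)
Lemma near_le_division n (e : 'I_n -> pseries R) (q : BP) a :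
  basis_mod (local_ideal tau p q) e -> ps_convergent a ->
  exists (c : 'rV[C]_n) (u v : pseries R), [/\ ps_convergent u,
    ps_convergent v & forall k, near_le k (fun m z1 z2 => series_fun a m z1 z2 -
      \sum_i c 0 i * series_fun (e i) m z1 z2 -
      p.[z1, z2] * series_fun u m z1 z2 - q.[z1, z2] * series_fun v m z1 z2)].
Proof.
move=> [_ hex] /hex [c [[u [v [cu cv E]]] _]]; exists c, u, v; split=> // k.
have := near_leD (near_le_mul_taylor k p cu) (near_le_mul_taylor k q cv).
congr near_le; apply/funext => m; apply/funext => z1; apply/funext => z2.
have : series_fun a m z1 z2 = \sum_i c 0 i * series_fun (e i) m z1 z2 +
  (series_fun (ps_mul u (taylor tau p)) m z1 z2 +
   series_fun (ps_mul v (taylor tau q)) m z1 z2).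
  rewrite /series_fun -rect_sum_lin -!rect_sumD; congr rect_sum.
  by apply/funext => j; apply/funext => l; rewrite -E addrC subrK.
move=> ->; move: (series_fun (ps_mul u _) _ _ _) (series_fun (ps_mul v _) _ _ _).
by move: (\sum_i _ * _) => S A B; ring.
Qed.

Definition lin_comb n (e : 'I_n -> pseries R) (c : 'rV[C]_n) N z1 z2 : C :=
  \sum_l c 0 l * series_fun (e l) N z1 z2.

(* Dividing [Q] by [(p, q)], and then the two quotients again, leaves
   O(|p|^2) because [|q| = |p|] on the torus. *)
Lemma near_le_division2 n (e : 'I_n -> pseries R) (q Q : BP) :
  (forall z1 z2, `|z1| = 1 -> `|z2| = 1 -> modc q.[z1, z2] = modc p.[z1, z2]) ->
  basis_mod (local_ideal tau p q) e ->
  exists c c1 c2 : 'rV[C]_n, near_le 2 (fun N z1 z2 => Q.[z1, z2] -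
     (lin_comb e c N z1 z2 + p.[z1, z2] * lin_comb e c1 N z1 z2 +
      q.[z1, z2] * lin_comb e c2 N z1 z2)).
Proof.
move=> hq be.
have [c [u [v [cu cv h0]]]] := near_le_division be (ps_convergent_taylor tau Q).
have [c1 [u1 [v1 [cu1 cv1 h1]]]] := near_le_division be cu.
have [c2 [u2 [v2 [cu2 cv2 h2]]]] := near_le_division be cv.
exists c, c1, c2.
have hp z1 z2 : `|z1| = 1 -> `|z2| = 1 -> modc p.[z1, z2] = modc p.[z1, z2].
  by [].
have t1 := near_leD (near_le_poly 2 Q) (h0 2%N).
have t2 := near_leD (near_leM hp (h1 1%N)) (near_leM hq (h2 1%N)).
have t3 := near_leD (near_leM hp (near_leM hp (near_le_series cu1)))
  (near_leM hp (near_leM hq (near_le_series cv1))).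
have t4 := near_leD (near_leM hq (near_leM hp (near_le_series cu2)))
  (near_leM hq (near_leM hq (near_le_series cv2))).
have := near_leD (near_leD t1 t2) (near_leD t3 t4).
congr near_le; apply/funext => N; apply/funext => z1; apply/funext => z2.
rewrite -/(lin_comb e c N z1 z2) -/(lin_comb e c1 N z1 z2) -/(lin_comb e c2 N z1 z2).
by ring.
Qed.

(** The coordinates of the first remainder and of the two second ones attach 3n scalars to each
    [Q i]. In a combination where all of them cancel, only the O(|p|^2) part is left. *)
Lemma fincodim_local n (e : 'I_n -> pseries R) (q : BP) :
  (forall z1 z2, `|z1| = 1 -> `|z2| = 1 -> modc q.[z1, z2] = modc p.[z1, z2]) ->
  basis_mod (local_ideal tau p q) e ->
  fincodim (n + (n + n)) (fun Q => near_le 2 (fun _ z1 z2 => Q.[z1, z2])).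
Proof.
move=> hq be m Q.
have /choice[c0 /choice[c1 /choice[c2 hc]]] i := near_le_division2 (Q i) hq be.
exists (row_mx (\matrix_i c0 i) (row_mx (\matrix_i c1 i) (\matrix_i c2 i))) => x.
have -> : 0 = row_mx 0 (row_mx 0 0) :> 'rV[C]_(n + (n + n)) by rewrite !row_mx0.
rewrite !mul_mx_row => /eq_row_mx[x0 /eq_row_mx[x1 x2]].
have := near_le_sum (fun i => near_leZ (x 0 i) (hc i)).
congr near_le; apply/funext => N; apply/funext => z1; apply/funext => z2.
have comb (c : 'I_m -> 'rV[C]_n) : x *m (\matrix_i c i) = 0 ->
    \sum_i x 0 i * lin_comb e (c i) N z1 z2 = 0.
  move=> h; under eq_bigr => i _ do rewrite mulr_sumr.
  rewrite exchange_big big1//= => l _.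
  under eq_bigr => i _ do rewrite mulrA; rewrite -mulr_suml.
  have := congr1 (fun M : 'rV_n => M 0 l) h; rewrite !mxE.
  by under eq_bigr => i _ do rewrite mxE; move=> ->; rewrite mul0r.
rewrite !horner_sum.
transitivity (\sum_i (x 0 i * (Q i).[z1, z2] - (x 0 i * lin_comb e (c0 i) N z1 z2 +
    p.[z1, z2] * (x 0 i * lin_comb e (c1 i) N z1 z2) +
    q.[z1, z2] * (x 0 i * lin_comb e (c2 i) N z1 z2)))).
  by apply: eq_bigr => i _; ring.
rewrite sumrB !big_split/= -!mulr_sumr !comb// !mulr0 !addr0 subr0.
by apply: eq_bigr => i _; rewrite !hornerM !hornerC.
Qed.

(** The sequence is constant, so the eventual bound holds outright for every [e], and [e] tends to
    0. *)
Lemma near_le_const (Q : BP) : near_le 2 (fun _ z1 z2 => Q.[z1, z2]) ->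
  exists B r, 0 < r /\ forall z1 z2, `|z1| = 1 -> `|z2| = 1 ->
    modc (z1 - tau.1) <= r -> modc (z2 - tau.2) <= r ->
    modc Q.[z1, z2] <= B * modc p.[z1, z2] ^+ 2.
Proof.
move=> [B [r [r0 h]]]; exists B, r; split=> // z1 z2 t1 t2 a1 a2.
apply/ler_addgt0Pr => e e0.
have [N _ /(_ N (leqnn N))] := h z1 z2 t1 t2 a1 a2 e e0; exact.
Qed.

End LocalCodimension.

(** * Domination on the whole torus *)

Section TorusBound.
Variable R : realType.
Local Notation C := R[i].
Local Notation BP := {poly {poly C}}.
Local Notation modc := (@ComplexField.Normc.normc R).
Implicit Types (p q P u : BP).

(** Boundedness of [q / P] written without division; it also forces [q] to vanish at the zeros of
    [P]. *)
Definition torus_le (P q : BP) := exists B, forall t, angles t ->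
  modc (torus_eval q t) <= B * modc (torus_eval P t).

Lemma torus_leD P q1 q2 : torus_le P q1 -> torus_le P q2 -> torus_le P (q1 + q2).
Proof.
move=> [B1 h1] [B2 h2]; exists (B1 + B2) => t Dt.
rewrite /torus_eval !hornerD; apply: le_trans (modcD _ _) _.
by rewrite mulrDl lerD// ?h1 ?h2.
Qed.

Lemma torus_leM P u q : torus_le P q -> torus_le P (u * q).
Proof.
move=> [B h]; have [K K0 hK] := torus_eval_bounded u; exists (K * B) => t Dt.
rewrite torus_evalM modcM -mulrA ler_pM ?modc_ge0//; exact: h.
Qed.

Lemma torus_le_refl P : torus_le P P.
Proof. by exists 1 => t _; rewrite mul1r. Qed.

Lemma torus_le0 P : torus_le P 0.
Proof. by rewrite -(mul0r P); apply: torus_leM; exact: torus_le_refl. Qed.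

Lemma torus_le_sum P m (f : 'I_m -> BP) :
  (forall i, torus_le P (f i)) -> torus_le P (\sum_i f i).
Proof.
by move=> h; elim/big_ind: _ => // [|*]; [exact: torus_le0|exact: torus_leD].
Qed.

Lemma torus_le_mul p q u v : torus_le p u -> torus_le q v -> torus_le (p * q) (u * v).
Proof.
move=> [A hA] [B hB]; exists (A * B) => t Dt.
rewrite !torus_evalM !modcM mulrACA ler_pM ?modc_ge0//; [exact: hA|exact: hB].
Qed.

Lemma torus_le_reversal p : torus_le p (reversal p).
Proof.
exists 1 => t _; rewrite mul1r /torus_eval modc_reversal_torus//; exact: norm_cis.
Qed.

Lemma torus_le_ideal p u v : torus_le p (u * p + v * reversal p).
Proof.
apply: torus_leD; apply: torus_leM; [exact: torus_le_refl|].
exact: torus_le_reversal.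
Qed.

(** Reduction modulo [r1] in the outer variable, then modulo [r2] in each coefficient, changes a
    numerator by something dominated by [P] and leaves finitely many coefficients; these are the
    columns of the matrix. *)
Lemma fincodim_torus_le P (r1 r2 : {poly C}) : r1 != 0 -> r2 != 0 ->
  torus_le P (map_poly polyC r1) -> torus_le P r2%:P ->
  exists D, fincodim D (torus_le P).
Proof.
move=> r10 r20 h1 h2.
(* The coefficients in the outer variable lie in [{poly C}], which is not a field, so exact division
   requires a monic divisor. *)
pose d : BP := map_poly polyC ((lead_coef r1)^-1 *: r1).
have lr : lead_coef r1 != 0 by rewrite lead_coef_eq0.
have hd : torus_le P d.
  by rewrite /d linearZ/= -mul_polyC; exact: torus_leM.
have dm : d \is monic.
  rewrite /d map_monic; first by rewrite monicE lead_coefZ mulVf.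
pose rem (Q : BP) : BP := \poly_(j < size d) ((Pdiv.Ring.rmodp Q d)`_j %% r2).
have remP Q : torus_le P (Q - rem Q).
  pose A : BP := \poly_(j < size d) ((Pdiv.Ring.rmodp Q d)`_j %/ r2).
  have -> : Q - rem Q = Pdiv.Ring.rdivp Q d * d + A * r2%:P.
    rewrite {1}(Pdiv.RingMonic.rdivp_eq dm Q) -addrA; congr (_ + _).
    apply/polyP => j; rewrite coefB coefMC !coef_poly.
    case: ltnP => jd.
      by rewrite {1}(Pdiv.Field.divp_eq (Pdiv.Ring.rmodp Q d)`_j r2) addrK.
    rewrite mul0r subr0 nth_default//; apply: leq_trans jd.
    by rewrite ltnW// Pdiv.Ring.ltn_rmodpN0// monic_neq0.
  by apply: torus_leD; exact: torus_leM.
exists (size d * size r2)%N => m Q.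
exists (\matrix_i mxvec (\matrix_(j < size d, k < size r2) (rem (Q i))`_j`_k)) => x xA.
have rem0 : \sum_i (x 0 i)%:P%:P * rem (Q i) = 0.
  apply/polyP => j; apply/polyP => k; rewrite !coef0 !coef_sum.
  under eq_bigr => i _ do rewrite !coefCM.
  have [jd|jd] := ltnP j (size d); last first.
    by rewrite big1// => i _; rewrite coef_poly ltnNge jd coef0 mulr0.
  have [kd|kd] := ltnP k (size r2); last first.
    rewrite big1// => i _; rewrite coef_poly jd nth_default ?mulr0//.
    by rewrite (leq_trans _ kd)// ltnW// ltn_modp.
  have := congr1 (fun M : 'rV_(size d * size r2) =>
    M 0 (mxvec_index (Ordinal jd) (Ordinal kd))) xA.
  rewrite !mxE => E0; rewrite -[RHS]E0; apply: eq_bigr => i _.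
  by rewrite !mxE mxvecE mxE.
have -> : \sum_i (x 0 i)%:P%:P * Q i = \sum_i (x 0 i)%:P%:P * (Q i - rem (Q i)).
  under [RHS]eq_bigr => i _ do rewrite mulrBr.
  by rewrite sumrB rem0 subr0.
by apply: torus_le_sum => i; exact: torus_leM.
Qed.

End TorusBound.

(** * Elimination and finiteness of the zeros on the torus *)

Section AtoralStable.
Variable R : realType.
Local Notation C := R[i].
Local Notation BP := {poly {poly C}}.
Local Notation modc := (@ComplexField.Normc.normc R).
Variable p : BP.
Hypothesis hp : atoral_stable p.

Lemma atoral_stable_neq0 : p != 0.
Proof.
apply/eqP => p0; have := hp.1 0 0; rewrite p0 !horner0 normr0 ltr01 eqxx.
by move=> /(_ isT isT).
Qed.

Lemma atoral_stable_elim : exists r1 r2 : {poly C}, [/\ r1 != 0, r2 != 0,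
  torus_le p (map_poly polyC r1) & torus_le p r2%:P].
Proof.
have [|[r2 [u2 [v2 [r20 E2]]]] [r1 [u1 [v1 [r10 E1]]]]] :=
    @coprime_ideal_const_both _ p (reversal p) atoral_stable_neq0.
  by move=> d u v Ep Eq; apply: (hp.2 d u v); rewrite mulrC.
by exists r1, r2; split=> //; rewrite ?E1 ?E2; exact: torus_le_ideal.
Qed.

Lemma fincodim_sqr : exists D, fincodim D (torus_le (p ^+ 2)).
Proof.
have [r1 [r2 [r10 r20 h1 h2]]] := atoral_stable_elim.
apply: (@fincodim_torus_le _ _ (r1 ^+ 2) (r2 ^+ 2)); rewrite ?expf_neq0//.
  by rewrite rmorphXn/=; exact: torus_le_mul.
by rewrite rmorphXn/=; exact: torus_le_mul.
Qed.

Lemma finite_roots (F : closedFieldType) (r : {poly F}) :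
  r != 0 -> finite_set [set x | root r x].
Proof.
move=> r0; have [s Es] := closed_field_poly_normal r.
apply: (@sub_finite_set _ _ [set` s]); last exact: finite_seq.
move=> x /=; rewrite {1}Es rootZ ?lead_coef_eq0//.
by rewrite root_prod_XsubC.
Qed.

Lemma finite_cis_preimage (z : C) :
  finite_set [set t : R | t \in `[0, 2 * pi] /\ cis t = z].
Proof.
pose a := acos (complex.Re z).
apply: (@sub_finite_set _ _ [set` [:: a; 2 * pi - a]]); last exact: finite_seq.
move=> t [+ Dz] /=; rewrite in_itv/= => /andP[t0 t2]; rewrite !inE.
have Re_z : complex.Re z = cos t by rewrite -Dz.
have [tpi|pit] := leP t pi.
  by apply/orP; left; rewrite /a Re_z cosK// in_itv/= t0.
apply/orP; right; rewrite /a Re_z.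
have -> : cos t = cos (2 * pi - t).
  by rewrite -cosN -[in RHS](addrC (- t)) mulr_natl cosD2pi.
rewrite cosK ?subKr//; rewrite in_itv/= subr_ge0 t2/= lerBlDr.
by rewrite mulr_natl mulr2n lerD2l ltW.
Qed.

Lemma finite_zero_angles : finite_set [set t | angles t /\ torus_eval p t = 0].
Proof.
have [r1 [r2 [r10 r20 [B1 h1] [B2 h2]]]] := atoral_stable_elim.
pose Z (r : {poly C}) := [set t : R | t \in `[0, 2 * pi] /\ r.[cis t] = 0].
have fZ r : r != 0 -> finite_set (Z r).
  move=> r0; apply: (@sub_finite_set _ _ (\bigcup_(z in [set x | root r x])
    [set t : R | t \in `[0, 2 * pi] /\ cis t = z])).
    by move=> t [t1 /eqP t2]; exists (cis t).
  apply: bigcup_finite; first exact: finite_roots.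
  by move=> z _; exact: finite_cis_preimage.
apply: (@sub_finite_set _ _ (Z r1 `*` Z r2)); last by apply: finite_setX; exact: fZ.
move=> t [Dt pt]; have := h1 t Dt; have := h2 t Dt.
rewrite pt modc0 !mulr0 /torus_eval => e2 e1.
have E2 : r2%:P.[cis t.1, cis t.2] = 0.
  by apply/eqP; rewrite -modc_eq0 eq_le e2 modc_ge0.
have E1 : (map_poly polyC r1).[cis t.1, cis t.2] = 0.
  by apply/eqP; rewrite -modc_eq0 eq_le e1 modc_ge0.
case: Dt => D1 D2; split; split=> //.
  by move: E1; rewrite horner_map/= hornerC.
by move: E2; rewrite hornerC.
Qed.

End AtoralStable.

(** * Quotients of polynomials on the torus *)

Section Compactness.
Variable R : realType.
Local Notation C := R[i].
Local Notation BP := {poly {poly C}}.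
Local Notation modc := (@ComplexField.Normc.normc R).

Lemma near_cis_modc (t : R * R) (r : R) : 0 < r ->
  \forall t' \near t, modc (cis t'.1 - cis t.1) <= r /\
    modc (cis t'.2 - cis t.2) <= r.
Proof.
move=> r0.
have h (q : BP) : torus_eval q t = 0 -> \forall t' \near t, modc (torus_eval q t') < r.
  move=> q0; have := @continuous_modc_torus R q t.
  move/cvgr_lt; apply; by rewrite q0 modc0.
have h1 := h ('X - (cis t.1)%:P%:P); have h2 := h ('X - (cis t.2)%:P)%:P.
have {}h1 : \forall t' \near t, modc (cis t'.1 - cis t.1) < r.
  have := h1; rewrite /torus_eval !hornerE subrr => /(_ erefl).
  by apply: filterS => t'; rewrite !hornerE.
have {}h2 : \forall t' \near t, modc (cis t'.2 - cis t.2) < r.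
  have := h2; rewrite /torus_eval !hornerE subrr => /(_ erefl).
  by apply: filterS => t'; rewrite !hornerE.
by apply: filterS2 h1 h2 => t' /ltW ? /ltW ?.
Qed.

(** Compactness in its near-covering form, with the constant as a parameter tending to infinity: a
    bound valid near each point for all large constants is uniform. Near a point where [P] does not
    vanish, |P| stays above half its value there and [q] is bounded. *)
Lemma torus_le_local (P q : BP) :
  (forall t, angles t -> torus_eval P t = 0 ->
    exists B r, 0 < r /\ forall z1 z2, `|z1| = 1 -> `|z2| = 1 ->
      modc (z1 - cis t.1) <= r -> modc (z2 - cis t.2) <= r ->
      modc q.[z1, z2] <= B * modc P.[z1, z2]) ->
  torus_le P q.
Proof.
move=> hloc; have [K K0 hK] := torus_eval_bounded q.
have := (compact_near_coveringP (@angles R)).1 (@compact_angles R).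
move=> /(_ R (pinfty_nbhs R)
  (fun B t => modc (torus_eval q t) <= B * modc (torus_eval P t)) _) [].
  move=> t Dt; have [Pt|Pt] := eqVneq (torus_eval P t) 0.
    have [B [r [r0 hB]]] := hloc t Dt Pt.
    near=> t' B' => /=.
    apply: le_trans (_ : B * modc (torus_eval P t') <= _).
      have [a1 a2] : modc (cis t'.1 - cis t.1) <= r /\ modc (cis t'.2 - cis t.2) <= r.
        by near: t'; exact: near_cis_modc.
      by apply: hB => //; exact: norm_cis.
    by rewrite ler_wpM2r ?modc_ge0//; near: B'; exact: nbhs_pinfty_ge.
  have m0 : 0 < modc (torus_eval P t) by rewrite modc_gt0.
  near=> t' B' => /=.
  apply: le_trans (hK t') _.
  have Pt' : modc (torus_eval P t) / 2 < modc (torus_eval P t').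
    near: t'; have := @continuous_modc_torus R P t; move/cvgr_gt; apply.
    by rewrite ltr_pdivrMr// mulr_natr mulr2n ltrDl.
  apply: le_trans (_ : K / (modc (torus_eval P t) / 2) * modc (torus_eval P t') <= _).
    by rewrite mulrAC ler_pdivlMr ?divr_gt0// ler_pM2l// ltW.
  by rewrite ler_wpM2r ?modc_ge0//; near: B'; exact: nbhs_pinfty_ge.
by move=> M [_ h]; exists (M + 1) => t Dt; apply: h => //; rewrite ltrDl.
Unshelve. all: by end_near. Qed.

End Compactness.

Section TorusLp.
Variable R : realType.
Local Notation C := R[i].
Local Notation BP := {poly {poly C}}.
Local Notation modc := (@ComplexField.Normc.normc R).
Local Notation mu2 := (lebesgue_measure \x lebesgue_measure)%E.
Implicit Types (P q : BP) (a : R).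

Lemma measure_angles_lty : (mu2 (@angles R) < +oo)%E.
Proof.
rewrite /angles product_measure1E; try exact: measurable_itv.
rewrite /= lebesgue_measure_itv; case: ifPn => _; last by rewrite mule0 ltry.
by rewrite -EFinB -EFinM ltry.
Qed.

Lemma measurable_modc_ratfun q P :
  measurable_fun setT (fun t : R * R => modc (ratfun q P (cis t.1, cis t.2))).
Proof.
rewrite (_ : (fun _ => _) = fun t : R * R =>
  modc (torus_eval q t) * modc (torus_eval P t) `^ (-1)).
  apply: measurable_funM; first exact: measurable_modc_torus.
  by apply: (measurableT_comp (measurable_powR (-1))); exact: measurable_modc_torus.
by apply/funext => t; rewrite powR_inv1 ?modc_ge0// -modcV -modcM.
Qed.

Lemma in_Lp_dominated a q P (g : R * R -> R) :
  mu2.-integrable (@angles R) (fun t => (g t)%:E) ->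
  (forall t, angles t -> modc (ratfun q P (cis t.1, cis t.2)) `^ a <= g t) ->
  in_Lp a (ratfun q P).
Proof.
move=> ig hg; rewrite /in_Lp; apply: le_integrable ig.
- exact: measurable_angles.
- apply/measurable_EFinP; apply: measurable_funTS.
  apply: (measurableT_comp (measurable_powR a)).
  exact: measurable_modc_ratfun.
- move=> t Dt; rewrite !abse_EFin lee_fin ger0_norm ?powR_ge0//.
  exact: le_trans (hg t Dt) (ler_norm _).
Qed.

Lemma integrable_cst_angles (k : R) :
  mu2.-integrable (@angles R) (fun=> k%:E).
Proof.
apply: (@measurable_bounded_integrable _ _ _ mu2 (fun=> k) (@angles R)).
- exact: measurable_angles.
- exact: measure_angles_lty.
- exact: measurable_cst.
- exact: bounded_cst.
Qed.

Lemma torus_le_in_Lp a q P : 0 < a -> torus_le P q -> in_Lp a (ratfun q P).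
Proof.
move=> a0 [B hB].
apply: (in_Lp_dominated (integrable_cst_angles (Num.max B 0 `^ a))) => t Dt.
have M0 : 0 <= Num.max B 0 by rewrite le_max lexx orbT.
apply: ge0_ler_powR; rewrite ?nnegrE ?modc_ge0//; first exact: ltW.
(* At a zero of [P] the quotient is 0 by the convention on inverses; the maximum with 0 covers this
   case. *)
rewrite le_max /ratfun modcM modcV; have [P0|P0] := eqVneq (modc (torus_eval P t)) 0.
  by rewrite [X in _ / X]P0 invr0 mulr0 lexx orbT.
rewrite ler_pdivrMr ?lt0r ?P0 ?modc_ge0//.
by rewrite (hB t Dt).
Qed.

(** x^a <= 1 + x^b for x >= 0, and constants are integrable because the torus has finite measure. *)
Lemma in_Lp_le a b q P : 0 < a -> a <= b ->
  in_Lp b (ratfun q P) -> in_Lp a (ratfun q P).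
Proof.
move=> a0 ab hb.
apply: (in_Lp_dominated (g := fun t => 1 + modc (ratfun q P (cis t.1, cis t.2)) `^ b)).
  apply: (integrableD _ (integrable_cst_angles 1) hb); exact: measurable_angles.
move=> t Dt; set x := modc _.
have x0 : 0 <= x by exact: modc_ge0.
have [x1|x1] := leP x 1.
  apply: le_trans (_ : 1 `^ a <= _); last by rewrite powR1 lerDl powR_ge0.
  by apply: ge0_ler_powR; rewrite ?nnegrE//; exact: ltW.
by apply: le_trans (ler_powR (ltW x1) ab) _; rewrite lerDr.
Qed.

Lemma in_LpZ a c q P :
  in_Lp a (ratfun q P) -> in_Lp a (ratfun (c%:P%:P * q) P).
Proof.
move=> h; apply: (in_Lp_dominated (g := fun t => modc c `^ a *
  modc (ratfun q P (cis t.1, cis t.2)) `^ a)).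
  apply: (integrableZl _ _ h); exact: measurable_angles.
move=> t Dt; rewrite -powRM ?modc_ge0// -modcM /ratfun !hornerM !hornerC mulrA.
exact: lexx.
Qed.

(** Exponents below 1 occur, so the triangle inequality for norms is replaced by |z + w| <= 2
    max(|z|, |w|), raised to the power [a]. *)
Lemma in_LpD a q1 q2 P : 0 < a ->
  in_Lp a (ratfun q1 P) -> in_Lp a (ratfun q2 P) -> in_Lp a (ratfun (q1 + q2) P).
Proof.
move=> a0 h1 h2.
apply: (in_Lp_dominated (g := fun t => 2 `^ a *
  (modc (ratfun q1 P (cis t.1, cis t.2)) `^ a +
   modc (ratfun q2 P (cis t.1, cis t.2)) `^ a))).
  have h12 : mu2.-integrable (@angles R)
      ((fun t => (modc (ratfun q1 P (cis t.1, cis t.2)) `^ a)%:E) \+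
       (fun t => (modc (ratfun q2 P (cis t.1, cis t.2)) `^ a)%:E))%E.
    by apply: integrableD h1 h2; exact: measurable_angles.
  by apply: (integrableZl _ _ h12); exact: measurable_angles.
move=> t Dt; have -> : ratfun (q1 + q2) P (cis t.1, cis t.2) =
    ratfun q1 P (cis t.1, cis t.2) + ratfun q2 P (cis t.1, cis t.2).
  by rewrite /ratfun !hornerD mulrDl.
set z := ratfun _ _ _; set w := ratfun _ _ _.
have z0 := modc_ge0 z; have w0 := modc_ge0 w.
have mono (u : R) : 0 <= u -> modc (z + w) <= 2 * u ->
    modc (z + w) `^ a <= 2 `^ a * u `^ a.
  move=> u0 hu; rewrite -powRM//.
  by apply: ge0_ler_powR; rewrite ?nnegrE ?modc_ge0 ?mulr_ge0//; exact: ltW.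
have := modcD z w; have [zw|zw] := leP (modc z) (modc w) => tri.
  apply: le_trans (mono _ w0 _) _; first by lra.
  by rewrite ler_wpM2l ?powR_ge0// lerDr powR_ge0.
apply: le_trans (mono _ z0 _) _; first by lra.
by rewrite ler_wpM2l ?powR_ge0// lerDl powR_ge0.
Qed.

Lemma in_Lp_sum a P (I : finType) (A : pred I) (f : I -> BP) : 0 < a ->
  (forall i, A i -> in_Lp a (ratfun (f i) P)) ->
  in_Lp a (ratfun (\sum_(i | A i) f i) P).
Proof.
move=> a0 h; elim/big_ind: _ => //.
  by apply: torus_le_in_Lp => //; exact: torus_le0.
by move=> q1 q2; exact: in_LpD.
Qed.

Lemma in_Lp_le_sup a (f : C * C -> C) : 0 < a -> in_Lp a f -> (a%:E <= Lp_sup f)%E.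
Proof. by move=> a0 h; apply: ereal_sup_ubound; exists a. Qed.

Lemma lt_Lp_sup a q P : 0 < a -> (a%:E < Lp_sup (ratfun q P))%E ->
  in_Lp a (ratfun q P).
Proof.
move=> a0 /ereal_sup_gt [_ [b [b0 hb] <-]]; rewrite lte_fin => ab.
exact: in_Lp_le (ltW ab) hb.
Qed.

(* Between the smallest index involved and the others there is an exponent for
   which all terms of a linear relation but one are integrable. *)
Lemma distinct_indices_independent P m (x : 'I_m -> R) (Q : 'I_m -> BP) :
  injective x -> (forall i, 0 < x i) ->
  (forall i, Lp_sup (ratfun (Q i) P) = (x i)%:E) ->
  forall c : 'rV[C]_m, c != 0 -> ~ torus_le P (\sum_i (c 0 i)%:P%:P * Q i).
Proof.
move=> xinj x0 hQ c /rV0Pn[i0 ci0] hle.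
have [i ci imin] := @Order.TotalTheory.arg_minP _ _ _ i0 (fun i => c 0 i != 0) x ci0.
have near_in (l : 'I_m) : \forall a \near (x i)^'+, l != i ->
    in_Lp a (ratfun ((c 0 l)%:P%:P * Q l) P).
  have [cl|cl] := eqVneq (c 0 l) 0.
    near=> a => _; rewrite cl !polyC0 mul0r; apply: torus_le_in_Lp.
      by rewrite (lt_trans (x0 i)).
    exact: torus_le0.
  have [<-|li] := eqVneq l i; first by near=> a; rewrite ?eqxx.
  have xil : x i < x l.
    rewrite lt_neqAle imin// andbT; apply: contra_neq li => /xinj->//.
  near=> a => _; apply: in_LpZ; apply: lt_Lp_sup.
    by rewrite (lt_trans (x0 i)).
  rewrite hQ lte_fin; near: a; exact: nbhs_right_lt.
have [a [xa hin]] : exists a, x i < a /\ forall l, l != i ->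
    in_Lp a (ratfun ((c 0 l)%:P%:P * Q l) P).
  near (x i)^'+ => a; exists a; split=> //.
  near: a; exact: filter_forall near_in.
have a0 : 0 < a by exact: lt_trans xa.
suff : in_Lp a (ratfun (Q i) P).
  by move=> /(in_Lp_le_sup a0); rewrite hQ lee_fin leNgt xa.
have -> : Q i = (c 0 i)^-1%:P%:P * ((\sum_i (c 0 i)%:P%:P * Q i) +
    (-1)%:P%:P * \sum_(l | l != i) (c 0 l)%:P%:P * Q l).
  rewrite [X in _ * (X + _)](bigD1 i)//= polyCN polyC1 polyCN polyC1 mulN1r addrK.
  by rewrite mulrA -!polyCM mulVf// mul1r.
apply: in_LpZ; apply: in_LpD => //; first exact: torus_le_in_Lp.
by apply: in_LpZ; apply: in_Lp_sum.
Unshelve. all: by end_near. Qed.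

End TorusLp.

(** * Sublevel sets on the torus *)

Section SublevelSets.
Variable R : realType.
Local Notation C := R[i].
Local Notation BP := {poly {poly C}}.
Local Notation modc := (@ComplexField.Normc.normc R).
Local Notation mu := (@lebesgue_measure R).
Local Notation mu2 := (lebesgue_measure \x lebesgue_measure)%E.

(** Mean value theorem: the derivative [cos] is at least [cos 1] on [0, 1]. *)
Lemma sin_ge_linear (x : R) : 0 <= x <= 1 -> cos 1 * x <= sin x.
Proof.
move=> /andP[x0 x1].
have [|c] := @MVT_segment R sin cos 0 x x0 (fun y _ => is_derive_sin y).
  by apply: continuous_subspaceT; exact: continuous_sin.
rewrite in_itv/= => /andP[c0 cx]; rewrite sin0 !subr0 => ->.
rewrite ler_wpM2r//; have [->|c1] := eqVneq c 1; first exact: lexx.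
have p1 : (1 : R) <= pi by rewrite (le_trans _ (pi_ge2 R))// ler1n.
rewrite ltW// ltr_cos ?in_itv/= ?c0 ?ler01 ?p1//.
  by rewrite lt_neqAle c1 (le_trans cx).
by rewrite (le_trans cx (le_trans x1 p1)).
Qed.

(** The chord has length 2 sin(|s - t| / 2); the half-angle must lie in [0, 1], whence the
    restriction to distance 2. *)
Lemma cis_expand (s t : R) : `|s - t| <= 2 ->
  cos 1 * `|s - t| <= modc (cis s - cis t).
Proof.
wlog ts : s t / t <= s => [H|].
  have [/H//|/ltW st] := leP t s.
  by rewrite distrC -modcN opprB; exact: H.
rewrite ger0_norm ?subr_ge0// => st2.
pose u := (s - t) / 2; have Du : s - t = u + u by rewrite /u -splitr.
have u01 : 0 <= u <= 1.
  by apply/andP; split; rewrite /u; lra.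
have su := sin_ge_linear u01.
have su0 : 0 <= sin u.
  by apply: le_trans su; rewrite mulr_ge0 //; [exact/ltW/cos1_gt0|case/andP: u01].
have -> : modc (cis s - cis t) = 2 * sin u.
  rewrite modcE/= -[RHS]ger0_norm ?mulr_ge0// -sqrtr_sqr; congr Num.sqrt.
  have := cosB s t; rewrite Du cosD => h.
  have := cos2Dsin2 u; have := cos2Dsin2 s; have := cos2Dsin2 t.
  move: h; rewrite !expr2; nra.
by rewrite Du mulrDr; lra.
Qed.

(** An outer-measure bound, so that measurability is asked of the cover and not of [S]. *)
Definition covered (S : set R) (m : R) :=
  exists U, [/\ measurable U, S `<=` U & (mu U <= m%:E)%E].

Lemma covered_sub S1 S2 m : S1 `<=` S2 -> covered S2 m -> covered S1 m.
Proof. by move=> h [U [mU SU lU]]; exists U; split=> //; exact: subset_trans SU. Qed.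

Lemma covered_setU S1 S2 m1 m2 :
  covered S1 m1 -> covered S2 m2 -> covered (S1 `|` S2) (m1 + m2).
Proof.
move=> [U1 [mU1 S1U l1]] [U2 [mU2 S2U l2]]; exists (U1 `|` U2); split.
- exact: measurableU.
- exact: setUSS.
- by apply: le_trans (measureU2 _ _ _) _ => //; rewrite EFinD leeD.
Qed.

Lemma covered_set0 m : 0 <= m -> covered set0 m.
Proof. by move=> m0; exists set0; split=> //; rewrite measure0 lee_fin. Qed.

(** Within a window of length 2, two angles whose points are both within [x] of [z] differ by at
    most [2 * x / cos 1]; an interval of that radius around one of them has length
    [4 / cos 1 * x]. *)
Definition arc_const : R := 4 / cos 1.

Lemma arc_const_gt0 : 0 < arc_const.
Proof. by rewrite divr_gt0 ?cos1_gt0. Qed.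

Lemma covered_arc (a x : R) (z : C) : 0 < x ->
  covered [set t | a <= t <= a + 2 /\ modc (cis t - z) < x] (arc_const * x).
Proof.
move=> x0; have c0 := cos1_gt0 R.
have [[t0 [/andP[at0 t0a] ht0]]|nt] :=
    pselect (exists t, a <= t <= a + 2 /\ modc (cis t - z) < x); last first.
  apply: covered_sub (covered_set0 _); first by move=> t ht; apply: nt; exists t.
  by rewrite mulr_ge0 ?ltW// arc_const_gt0.
exists `[t0 - 2 * x / cos 1, t0 + 2 * x / cos 1]%classic; split.
- exact: measurable_itv.
- move=> t [/andP[ta at2] ht] /=.
  have d2 : `|t - t0| <= 2 by rewrite ler_norml; apply/andP; split; lra.
  have h : cos 1 * `|t - t0| <= 2 * x.
    apply: le_trans (cis_expand d2) _.
    have -> : (cis t - cis t0 : C) = (cis t - z) - (cis t0 - z).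
      by rewrite opprB addrA subrK.
    by apply: le_trans (modcB _ _) _; lra.
  have : `|t - t0| <= 2 * x / cos 1 by rewrite ler_pdivlMr// mulrC.
  by rewrite in_itv/= -ler_distl.
- rewrite lebesgue_measure_itv/=; case: ifPn => _; last first.
    by rewrite lee_fin mulr_ge0 ?ltW// arc_const_gt0.
  rewrite -EFinB lee_fin /arc_const le_eqVlt; apply/orP; left; apply/eqP.
  by move: (cos 1) => c; ring.
Qed.

(** Since [2 * pi < 8], four windows of length 2 cover the circle. *)
Lemma covered_cis (x : R) (z : C) : 0 < x ->
  covered [set t | 0 <= t <= 2 * pi /\ modc (cis t - z) < x] (4 * arc_const * x).
Proof.
move=> x0.
have h := covered_setU (covered_setU (covered_arc 0 z x0) (covered_arc 2 z x0))
  (covered_setU (covered_arc 4 z x0) (covered_arc 6 z x0)).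
have -> : 4 * arc_const * x = arc_const * x + arc_const * x +
  (arc_const * x + arc_const * x) by ring.
apply: covered_sub h => t [/andP[t0 t2] ht].
have p4 : pi < 4 :> R.
  by have := pihalf_lt2 R; rewrite ltr_pdivrMr// -natrM.
have [h2|h2] := leP t 2; first by left; left; split=> //; rewrite t0 add0r.
have [h4|h4] := leP t 4.
  by left; right; split=> //; apply/andP; split; lra.
have [h6|h6] := leP t 6.
  by right; left; split=> //; apply/andP; split; lra.
by right; right; split=> //; apply/andP; split; lra.
Qed.

(** If all factors were at least [x], the product would be at least [x ^+ size s]; so some factor is
    small and its arc covers the point. *)
Lemma covered_prod (x : R) (s : seq C) : 0 < x ->
  covered [set t | 0 <= t <= 2 * pi /\
      \prod_(z <- s) modc (cis t - z) < x ^+ size s]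
    ((size s)%:R * (4 * arc_const * x)).
Proof.
move=> x0; elim: s => [|z s IH].
  by apply: covered_sub (covered_set0 _); rewrite ?mul0r// => t []; rewrite big_nil ltxx.
have -> : (size (z :: s))%:R * (4 * arc_const * x) =
    4 * arc_const * x + (size s)%:R * (4 * arc_const * x).
  by rewrite (mulrS (1 : R) (size s)) mulrDl mul1r.
apply: covered_sub (covered_setU (covered_cis z x0) IH) => t [tI]; rewrite big_cons exprS.
have [hz|hz] := ltP (modc (cis t - z)) x; first by left.
have [hs|hs] := ltP (\prod_(w <- s) modc (cis t - w)) (x ^+ size s); first by right.
by rewrite ltNge ler_pM ?exprn_ge0// ltW.
Qed.

Lemma covered_horner (x : R) (q : {poly C}) : 0 < x -> q != 0 ->
  covered [set t | 0 <= t <= 2 * pi /\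
      modc q.[cis t] < modc (lead_coef q) * x ^+ (size q).-1]
    ((size q).-1%:R * (4 * arc_const * x)).
Proof.
move=> x0 q0; have [s Es] := closed_field_poly_normal q.
have lq0 : lead_coef q != 0 by rewrite lead_coef_eq0.
have ss : (size q).-1 = size s by rewrite Es size_scale// size_prod_XsubC.
rewrite ss; apply: covered_sub (covered_prod s x0) => t [tI].
rewrite {1}Es hornerZ modcM ltr_pM2l ?modc_gt0// horner_prod modc_prod => h.
split=> //; apply: le_lt_trans h; rewrite le_eqVlt; apply/orP; left; apply/eqP.
by apply: eq_bigr => z _; rewrite hornerXsubC.
Qed.

Definition sublevel (f : BP) (y : R) : set (R * R) :=
  [set t | angles t /\ modc (torus_eval f t) < y].

Lemma measurable_sublevel f y : measurable (sublevel f y).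
Proof.
rewrite (_ : sublevel f y = @angles R `&`
  ((fun t => modc (torus_eval f t)) @^-1` `]-oo, y[)).
  apply: measurableI; first exact: measurable_angles.
  rewrite -[X in measurable X]setTI.
  by apply: measurable_modc_torus => //; exact: measurable_itv.
by apply/seteqP; split=> t /= [] ? h; split=> //; move: h; rewrite in_itv.
Qed.

(* For fixed [z1] off a small set, [f] is a polynomial in [z2] whose leading
   coefficient is bounded below; the small set is a sublevel set of that
   leading coefficient. *)
Lemma measure_sublevel (f : BP) : f != 0 -> exists c0 K k, [/\ 0 < c0, 0 <= K &
  forall x, 0 < x -> (mu2 (sublevel f (c0 * x ^+ k)) <= (K * x)%:E)%E].
Proof.
move=> f0; pose g := swapXY f.
have g0 : g != 0 by rewrite swapXY_eq0.
pose l := lead_coef g; have l0 : l != 0 by rewrite lead_coef_eq0.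
pose n := (size g).-1; pose m := (size l).-1; pose c := lead_coef l.
have c0 : 0 < modc c by rewrite modc_gt0 lead_coef_eq0.
pose K1 := n%:R * (4 * arc_const); pose K2 := m%:R * (4 * arc_const).
have A0 : 0 <= 4 * arc_const by rewrite mulr_ge0// ltW// arc_const_gt0.
have K10 : 0 <= K1 by rewrite mulr_ge0.
have K20 : 0 <= K2 by rewrite mulr_ge0.
have pi20 : 0 <= 2 * pi :> R by rewrite mulr_ge0// pi_ge0.
(* The exceptional [z1] have measure at most [K2 * x] and contribute slices of full length [2 * pi];
   over the other [z1] the slices have measure at most [K1 * x]. The exponent adds the degree [m] of
   the leading coefficient to the degree [n] in [z2]. *)
exists (modc c), (2 * pi * K2 + K1 * (2 * pi)), (m + n)%N; split=> //.
  by rewrite addr_ge0// mulr_ge0.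
move=> x x0; set E := sublevel _ _.
have [U [mU BU lU]] := covered_horner x0 l0.
pose I : set R := `[0, 2 * pi]%classic.
have muI : mu I = (2 * pi)%:E.
  rewrite lebesgue_measure_itv/= lte_fin; case: ifPn; rewrite -?EFinB ?subr0//.
  by rewrite -leNgt => h; congr EFin; apply/eqP; rewrite eq_le h pi20.
have mI : measurable I by exact: measurable_itv.
have mE : measurable E by exact: measurable_sublevel.
have key t1 : (mu (xsection E t1) <=
    (2 * pi)%:E * (\1_U t1)%:E + (K1 * x)%:E * (\1_I t1)%:E)%E.
  have mX : measurable (xsection E t1) by exact: measurable_xsection.
  have pos1 : (0 <= (2 * pi : R)%:E * (\1_U t1)%:E)%E by rewrite mule_ge0// lee_fin.
  have pos2 : (0 <= (K1 * x)%:E * (\1_I t1)%:E)%E.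
    by rewrite mule_ge0// lee_fin mulr_ge0// ltW.
  have [It|It] := pselect (I t1); last first.
    rewrite (_ : xsection E t1 = set0) ?measure0 ?adde_ge0//.
    apply/seteqP; split=> // t2; rewrite /xsection/= inE => -[[h _] _].
    exact: It.
  have [Ut|Ut] := pselect (U t1).
    apply: le_trans (leeDl _ pos2); rewrite indicE mem_set// mule1 -muI.
    apply: le_measure; rewrite ?inE//.
    by move=> t2; rewrite /xsection/= inE => -[[_ h] _].
  apply: le_trans (leeDr _ pos1); rewrite [in leRHS]indicE mem_set// mule1.
  have lt1 : modc c * x ^+ m <= modc l.[cis t1].
    by rewrite leNgt; apply/negP => h; apply: Ut; apply: BU; split.
  have lt0 : l.[cis t1] != 0.
    by rewrite -modc_gt0; apply: lt_le_trans lt1; rewrite mulr_gt0// exprn_gt0.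
  pose h := evY (cis t1) g.
  have lh : lead_coef h = l.[cis t1] by rewrite /h /evY lead_coef_map_eq.
  have h0 : h != 0 by rewrite -lead_coef_eq0 lh.
  have sh : (size h).-1 = n by rewrite /h /evY size_map_poly_id0.
  have [V [mV SV lV]] := covered_horner x0 h0.
  have -> : K1 * x = n%:R * (4 * arc_const * x) by rewrite /K1 -mulrA.
  rewrite -sh; apply: le_trans lV; apply: le_measure; rewrite ?inE//.
  move=> t2; rewrite /xsection/= inE => -[[_ I2] h2]; apply: SV; split.
    by move: I2; rewrite /= in_itv.
  rewrite sh lh; have -> : h.[cis t2] = torus_eval f (t1, t2).
    by rewrite /h /evY -horner_swapXY swapXYK.
  apply: lt_le_trans h2 _.
  by rewrite exprD mulrA ler_wpM2r// exprn_ge0// ltW.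
rewrite /product_measure1.
apply: (@le_trans _ _ (\int[mu]_t1 ((2 * pi)%:E * (\1_U t1)%:E +
    (K1 * x)%:E * (\1_I t1)%:E))%E).
  apply: ge0_le_integral => //=.
  - exact: measurable_fun_xsection.
  - by apply: emeasurable_funD; apply: measurable_funeM; exact/measurable_EFinP.
rewrite ge0_integralD//=; first last.
- by apply: measurable_funeM; exact/measurable_EFinP.
- by move=> t _; rewrite mule_ge0// lee_fin mulr_ge0// ltW.
- by apply: measurable_funeM; exact/measurable_EFinP.
- by move=> t _; rewrite mule_ge0// lee_fin.
rewrite !ge0_integralZl//=; try exact/measurable_EFinP.
- rewrite !integral_indic// !setIT [X in (_ + _ * X)%E]muI.
  have -> : (2 * pi * K2 + K1 * (2 * pi)) * x =
      2 * pi * (K2 * x) + K1 * x * (2 * pi) by ring.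
  rewrite EFinD; apply: leeD; last by rewrite -EFinM lee_fin.
  rewrite [leRHS]EFinM; apply: lee_wpmul2l; first by rewrite lee_fin.
  by rewrite /K2 -[m%:R * _ * x]mulrA.
- by rewrite lee_fin mulr_ge0// ltW.
Qed.

End SublevelSets.

(** * A positive exponent of integrability for every quotient *)

Section SomeIntegrability.
Variable R : realType.
Local Notation C := R[i].
Local Notation BP := {poly {poly C}}.
Local Notation modc := (@ComplexField.Normc.normc R).
Local Notation mu2 := (lebesgue_measure \x lebesgue_measure)%E.

(* The dyadic pieces [c0 4^(-nk) <= |P| < c0 4^(-(n-1)k)] have measure O(4^-n);
   the exponent is chosen so that |P|^-a is O(2^n) there. *)
Lemma in_Lp_small (Q P : BP) : P != 0 -> exists2 a, 0 < a & in_Lp a (ratfun Q P).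
Proof.
move=> P0; have [c0 [K [k [c00 K0 hK]]]] := measure_sublevel P0.
have [B B0 hB] := torus_eval_bounded Q.
pose x n : R := 4^-1 ^+ n.
have x0 n : 0 < x n by rewrite exprn_gt0.
have x1 n : x n <= 1 by rewrite exprn_ile1// invf_le1// ler1n.
(* The exponent [k.+1] instead of [k] makes the thresholds tend to 0 even when [k = 0]. If [n] is
   the first index whose threshold [c0 * x n ^+ k.+1] is at most |P(t)|, then t lies in [F n]; [F 0]
   is the whole torus for the case where no earlier threshold exists. *)
pose F n := if n is j.+1 then sublevel P (c0 * x j ^+ k.+1) else @angles R.
have mF n : measurable (F n).
  by case: n => [|n]; [exact: measurable_angles|exact: measurable_sublevel].
have F_angles n t : F n t -> angles t by case: n => [//|n] [].
(* The factor 4 absorbs the shift from [x n] to [x n.+1]. *)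
pose K' := Num.max (fine (mu2 (@angles R))) (4 * K).
have muF n : (mu2 (F n) <= (K' * x n)%:E)%E.
  case: n => [|n] /=.
    rewrite /x expr0 mulr1 -[leLHS]fineK ?lee_fin ?/K' ?le_max ?lexx//.
    by rewrite ge0_fin_numE//; exact: measure_angles_lty.
  apply: (@le_trans _ _ (mu2 (sublevel P (c0 * x n ^+ k)))).
    apply: le_measure; rewrite ?inE; try exact: measurable_sublevel.
    move=> t [tA ht]; split=> //; apply: lt_le_trans ht _.
    by rewrite ler_pM2l// exprS ler_piMl// exprn_ge0// ltW.
  apply: le_trans (hK _ (x0 n)) _; rewrite lee_fin.
  have -> : K * x n = 4 * K * x n.+1 by rewrite /x exprS; lra.
  by rewrite ler_wpM2r ?/K' ?le_max ?lexx ?orbT//; exact: ltW.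
(* Chosen so that [x n ^+ k.+1] to the power [- a] is 2^n; against the measure O(4^-n) of [F n] this
   gives a convergent geometric series. *)
pose a : R := (2 * k.+1)%:R^-1.
have a0 : 0 < a by rewrite invr_gt0 ltr0n.
exists a => //; pose W := (B / c0) `^ a.
have W0 : 0 <= W by exact: powR_ge0.
have K'0 : 0 <= K' by rewrite /K' le_max (mulr_ge0 _ K0) ?orbT.
pose g n (t : R * R) := ((W * 2 ^+ n)%:E * (\1_(F n) t)%:E)%E.
have g0 n t : (0 <= g n t)%E.
  by rewrite mule_ge0 ?lee_fin// mulr_ge0// exprn_ge0.
have mg n : measurable_fun (@angles R) (g n).
  by apply: measurable_funeM; apply/measurable_EFinP; exact: measurable_indic.
have bound t : angles t ->
    ((modc (ratfun Q P (cis t.1, cis t.2)) `^ a)%:E <= \sum_(n <oo) g n t)%E.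
  move=> tA; have sum0 : (0 <= \sum_(n <oo) g n t)%E by exact: nneseries_ge0.
  rewrite /ratfun modcM modcV -/(torus_eval Q t) -/(torus_eval P t).
  have [Pt|Pt] := eqVneq (modc (torus_eval P t)) 0.
    by rewrite Pt invr0 mulr0 powR0// gt_eqF.
  have {}Pt : 0 < modc (torus_eval P t) by rewrite lt0r Pt modc_ge0.
  have ex : exists n, c0 * x n ^+ k.+1 <= modc (torus_eval P t).
    have [N _ /(_ N (leqnn N))/= hN] := half_power_small c0 0 Pt.
    exists N; apply: le_trans hN; rewrite subn0 ler_pM2l// exprS.
    have h1 : x N * x N ^+ k <= x N.
      by apply: ler_piMr; [exact: ltW|apply: exprn_ile1; [exact: ltW|]].
    apply: le_trans h1 _.
    by rewrite lerXn2r ?nnegrE// lef_pV2 ?posrE// ler_nat.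
  case: (ex_minnP ex) => n hn nmin.
  have Fn : F n t.
    case: n nmin {hn} => [//|n] nmin; split=> //; rewrite ltNge; apply/negP.
    by move=> /nmin; rewrite ltnn.
  apply: (@le_trans _ _ (g n t)); last first.
    apply: (@le_trans _ _ (\sum_(0 <= i < n.+1) g i t)%E); last exact: nneseries_lim_ge.
    by rewrite big_nat_recr//= leeDr// sume_ge0.
  rewrite /g indicE mem_set// mule1 lee_fin.
  have -> : W * 2 ^+ n = (B / c0 * (2 ^+ n) ^+ (2 * k.+1)) `^ a.
    rewrite powRM ?divr_ge0 ?exprn_ge0 ?ltW//; congr (_ * _).
    rewrite -[in X in _ = X `^ _]powR_mulrn ?exprn_ge0// -powRrM /a divff ?pnatr_eq0//.
    by rewrite powRr1 ?exprn_ge0.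
  apply: ge0_ler_powR;
    rewrite ?nnegrE ?mulr_ge0 ?invr_ge0 ?modc_ge0 ?exprn_ge0//; try exact: ltW.
  rewrite ler_pdivrMr//; apply: le_trans (hB t) _.
  have -> : (2 ^+ n) ^+ (2 * k.+1) = (x n ^+ k.+1)^-1.
    rewrite /x !exprVn invrK (_ : 4 = 2 ^+ 2 :> R); last by rewrite -natrX.
    by rewrite -!exprM; congr (_ ^+ _); rewrite mulnCA ?mulnA.
  have X0 : 0 < x n ^+ k.+1 by rewrite exprn_gt0.
  move: (x n ^+ k.+1) (modc (torus_eval P t)) X0 hn => X p' X0 hn.
  have -> : B / c0 / X * p' = B * (p' / (c0 * X)) by rewrite invfM; ring.
  by apply: ler_peMr; [exact: ltW|rewrite ler_pdivlMr ?mul1r// mulr_gt0].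
rewrite /in_Lp; apply/integrableP; split.
  apply/measurable_EFinP; apply: measurable_funTS.
  apply: (measurableT_comp (measurable_powR a)).
  exact: measurable_modc_ratfun.
apply: (@le_lt_trans _ _ (\int[mu2]_(t in @angles R) \sum_(n <oo) g n t)%E).
  apply: ge0_le_integral => //.
  - exact: measurable_angles.
  - apply/measurable_EFinP; apply: measurableT_comp => //; apply: measurable_funTS.
    apply: (measurableT_comp (measurable_powR a)).
    exact: measurable_modc_ratfun.
  - apply: ge0_emeasurable_sum => [n t _ _|n _]; [exact: g0|exact: mg].
  - by move=> t tA; rewrite /= ger0_norm ?powR_ge0//; exact: bound.
rewrite integral_nneseries//; last exact: measurable_angles.
(* 2^n 4^-n is rewritten as 2 / 2^(n+1) to fit the summation lemma [epsilon_trick0]. *)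
apply: (@le_lt_trans _ _ (\sum_(n <oo) (2 * W * K' / (2 ^ n.+1)%:R)%:E)%E); last first.
  apply: le_lt_trans (epsilon_trick0 xpredT _) (ltry _).
  by rewrite !mulr_ge0.
apply: lee_nneseries => [n _ _|n _].
  by apply: integral_ge0 => t _.
rewrite ge0_integralZl//; last by rewrite lee_fin mulr_ge0// exprn_ge0.
- rewrite integral_indic; [|exact: measurable_angles|exact: mF].
  rewrite setIidl; last exact: F_angles.
  apply: (@le_trans _ _ ((W * 2 ^+ n)%:E * (K' * x n)%:E)%E).
    by apply: lee_wpmul2l; [rewrite lee_fin mulr_ge0// exprn_ge0|exact: muF].
  rewrite -EFinM lee_fin natrX le_eqVlt; apply/orP; left; apply/eqP.
  have -> : x n = 2 ^- n * 2 ^- n.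
    by rewrite /x exprVn -invfM -exprMn -natrM.
  have : 2 ^+ n != 0 :> R by rewrite expf_neq0.
  by rewrite exprS; move: (2 ^+ n) => y y0; field.
- exact: measurable_angles.
- by apply/measurable_EFinP; apply: measurable_indic; exact: mF.
Qed.

End SomeIntegrability.

(** * Derivatives of rational functions *)

Section RationalDerivative.
Variable K : numFieldType.

Lemma is_derive_horner (p : {poly K}) (x : K^o) :
  is_derive x 1 ((fun w => p.[w]) : K^o -> K^o) p^`().[x].
Proof.
elim/poly_ind: p => [|p c IH].
  rewrite deriv0 horner0 (_ : (fun w => _) = cst 0); first exact: is_derive_cst.
  by apply/funext => w; rewrite horner0.
rewrite (_ : (fun w => _) = (fun w : K^o => p.[w] : K^o) * id + cst c); last first.
  by apply/funext => w; rewrite !hornerE.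
apply: is_derive_eq.
by rewrite addr0 derivMXaddC !hornerE /GRing.scale/= mulr1 (mulrC x).
Qed.

Lemma derive1_horner_ratio (q p : {poly K}) (x : K) : p.[x] != 0 ->
  derive1 (fun w : K => (q.[w] / p.[w] : K^o)) x =
    (q^`() * p - q * p^`()).[x] / (p ^+ 2).[x].
Proof.
move=> px; rewrite derive1E.
have [dq Dq] := is_derive_horner q x; have [dp Dp] := is_derive_horner p x.
have dV : derivable (fun w : K^o => (p.[w])^-1 : K^o) x 1 by exact: derivableV.
rewrite (_ : (fun w => _) =
  (fun w : K^o => q.[w] : K^o) * (fun w : K^o => (p.[w])^-1 : K^o)); last by [].
rewrite deriveM// deriveV// Dq Dp !hornerE /GRing.scale/=.
by field.
Qed.

End RationalDerivative.

(** * From the partial derivative to a quotient over [p ^+ 2] *)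

Section PartialDerivative.
Variable R : realType.
Local Notation C := R[i].
Local Notation BP := {poly {poly C}}.
Local Notation modc := (@ComplexField.Normc.normc R).
Local Notation mu2 := (lebesgue_measure \x lebesgue_measure)%E.
Implicit Types (p q : BP).

Definition partial1_num q p : BP := q^`() * p - q * p^`().

Lemma partial1_ratfun q p (z : C * C) : p.[z.1, z.2] != 0 ->
  partial1 (ratfun q p) z = ratfun (partial1_num q p) (p ^+ 2) z.
Proof.
have ev (u : BP) w : u.[w, z.2] = (evY z.2 u).[w].
  by rewrite /evY -horner_swapXY horner2_swapXY.
move=> pz; rewrite /partial1 /ratfun.
rewrite (_ : (fun w => _) = fun w => (evY z.2 q).[w] / (evY z.2 p).[w] : C^o); last first.
  by apply/funext => w /=; rewrite !ev.
rewrite derive1_horner_ratio -?ev// !ev.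
by rewrite /evY rmorphXn rmorphB !rmorphM/= !deriv_map.
Qed.

Lemma measurable_finite (Z : set (R * R)) : finite_set Z -> measurable Z.
Proof.
move=> fZ; rewrite (_ : Z = \bigcup_(t in Z) ([set t.1] `*` [set t.2])).
  by apply: fin_bigcup_measurable => // t _; apply: measurableX; exact: measurable_set1.
by apply/seteqP; split=> [[x y] Zt|[x y] [[a b] Zt] /= [-> ->]//]; exists (x, y).
Qed.

Lemma measure_finite (Z : set (R * R)) : finite_set Z -> mu2 Z = 0%E.
Proof.
move=> fZ; have f1 : finite_set (fst @` Z) by exact: finite_image.
have f2 : finite_set (snd @` Z) by exact: finite_image.
have m1 (A : set R) : finite_set A -> measurable A.
  move=> /finite_set_countable; apply: countable_measurable => t.
  exact: measurable_set1.
have h0 : mu2 ((fst @` Z) `*` (snd @` Z)) = 0%E.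
  rewrite product_measure1E; [|exact: m1|exact: m1].
  rewrite [X in (X * _)%E]countable_lebesgue_measure0 ?mul0e//.
  exact: finite_set_countable.
apply: subset_measure0 h0.
- exact: measurable_finite.
- by apply: measurableX; exact: m1.
- by move=> t Zt; split; exists t.
Qed.

(** Nothing is known of [f] on [Z], but every subset of the finite set [Z] is measurable and null,
    so its values there affect neither measurability nor the integral. *)
Lemma in_Lp_eq_off_finite a (f : C * C -> C) q P (Z : set (R * R)) :
  finite_set Z ->
  (forall t, angles t -> ~ Z t ->
    f (cis t.1, cis t.2) = ratfun q P (cis t.1, cis t.2)) ->
  in_Lp a f <-> in_Lp a (ratfun q P).
Proof.
move=> fZ hf.
pose h1 (t : R * R) := (modc (f (cis t.1, cis t.2)) `^ a)%:E.
pose h2 (t : R * R) := (modc (ratfun q P (cis t.1, cis t.2)) `^ a)%:E.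
have mZ := measurable_finite fZ; have mD := @measurable_angles R.
have m2 : measurable_fun (@angles R) h2.
  apply/measurable_EFinP; apply: measurable_funTS.
  apply: (measurableT_comp (measurable_powR a)).
  exact: measurable_modc_ratfun.
have e12 t : angles t -> ~ Z t -> h1 t = h2 t by move=> tA tZ; rewrite /h1 hf.
have m1 : measurable_fun (@angles R) h1.
  move=> _ B mB.
  have -> : @angles R `&` h1 @^-1` B =
      ((@angles R `&` h2 @^-1` B) `\` Z) `|` (Z `&` (@angles R `&` h1 @^-1` B)).
    apply/seteqP; split=> t.
      move=> [tA tB]; have [Zt|Zt] := pselect (Z t); first by right.
      by left; split=> //; split=> //; rewrite /preimage/= -e12.
    by move=> [[[tA tB] Zt]|[_ []]//]; split=> //; rewrite /preimage/= e12.
  apply: measurableU; first by apply: measurableD => //; exact: m2.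
  by apply: measurable_finite; exact: finite_setIl.
have n1 : mu2.-integrable (@angles R) h1 <-> mu2.-integrable (@angles R `\` Z) h1.
  by apply: negligible_integrable => //; exact: measure_finite.
have n2 : mu2.-integrable (@angles R) h2 <-> mu2.-integrable (@angles R `\` Z) h2.
  by apply: negligible_integrable => //; exact: measure_finite.
have mDZ : measurable (@angles R `\` Z) by exact: measurableD.
split.
  move=> /n1 i1; apply/n2; apply: eq_integrable i1 => // t.
  by rewrite inE => -[tA tZ]; exact: e12.
move=> /n2 i2; apply/n1; apply: eq_integrable i2 => // t.
by rewrite inE => -[tA tZ]; exact/esym/e12.
Qed.

Lemma Lp_sup_partial1 p q : atoral_stable p ->
  Lp_sup (partial1 (ratfun q p)) = Lp_sup (ratfun (partial1_num q p) (p ^+ 2)).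
Proof.
move=> hp; rewrite /Lp_sup.
have h a : in_Lp a (partial1 (ratfun q p)) <->
    in_Lp a (ratfun (partial1_num q p) (p ^+ 2)).
  apply: in_Lp_eq_off_finite (finite_zero_angles hp) _ => t tA tZ.
  apply: partial1_ratfun => /=; apply/eqP => pt; exact: tZ.
by congr (ereal_sup [set _ | _ in _]); apply/seteqP; split=> a [a0 /h].
Qed.

End PartialDerivative.

(** * Counting the indices *)

Section IndexCount.
Variable R : realType.
Local Notation C := R[i].
Local Notation BP := {poly {poly C}}.
Local Notation modc := (@ComplexField.Normc.normc R).

Lemma dim_mod_ge0 (I : set (pseries R)) : (0 <= dim_mod I)%E.
Proof. by apply: le_ereal_inf_tmp => _ [n _ <-]; rewrite lee_fin. Qed.

(** A nonempty set of natural numbers has a least element, which provides a basis realizing the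
    infimum. *)
Lemma dim_mod_attained (I : set (pseries R)) : dim_mod I = +oo%E \/
  exists n (e : 'I_n -> pseries R), basis_mod I e /\ dim_mod I = n%:R%:E.
Proof.
pose A := [set n | exists e : 'I_n -> pseries R, basis_mod I e].
have [[n0 An0]|nA] := pselect (exists n, A n); last first.
  left; rewrite /dim_mod (_ : [set _ | _ in _] = set0) ?ereal_inf0//.
  by apply/seteqP; split=> // x [n An _]; apply: nA; exists n.
have ex : exists n, `[< A n >] by exists n0; exact/asboolP.
right; case: (ex_minnP ex) => n /asboolP [e he] nmin; exists n, e; split=> //.
apply/eqP; rewrite eq_le; apply/andP; split.
  by apply: ereal_inf_lbound; exists n => //; exists e.
apply: le_ereal_inf_tmp => _ [k Ak <-]; rewrite lee_fin ler_nat; apply: nmin.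
exact/asboolP.
Qed.

Variable p : BP.
Hypothesis hp : atoral_stable p.

Let p20 : p ^+ 2 != 0.
Proof. by rewrite expf_neq0// atoral_stable_neq0. Qed.

Lemma Lp_sup_gt0 q : (0 < Lp_sup (ratfun q (p ^+ 2)))%E.
Proof.
have [a a0 ha] := in_Lp_small q p20.
by apply: (@lt_le_trans _ _ a%:E); rewrite ?lte_fin//; exact: in_Lp_le_sup.
Qed.

Lemma fincodim_index_bound D m (x : 'I_m -> R) (Q : 'I_m -> BP) :
  fincodim D (torus_le (p ^+ 2)) -> injective x ->
  (forall i, Lp_sup (ratfun (Q i) (p ^+ 2)) = (x i)%:E) -> (m <= D)%N.
Proof.
move=> hD xinj hx; rewrite leqNgt; apply/negP => Dm.
have [c c0 hc] := fincodim_dependent Q hD Dm.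
apply: (distinct_indices_independent xinj _ hx c0 hc) => i.
by rewrite -lte_fin -hx; exact: Lp_sup_gt0.
Qed.

(** The torus zeros of [p] are finitely many and are common zeros, since the reversal has the same
    modulus there. When all local multiplicities are finite, the local conditions at these points
    are imposed together and [torus_le_local] makes them global. *)
Lemma fincodim_torus_mult :
  torus_mult p (reversal p) = +oo%E \/ exists D,
    fincodim (3 * D) (torus_le (p ^+ 2)) /\
    (D%:R%:E <= torus_mult p (reversal p))%E.
Proof.
pose Z := (fun t : R * R => (cis t.1 : C, cis t.2 : C)) @`
  [set t | angles t /\ torus_eval p t = 0].
have /finite_seqP[s0 Zs0] : finite_set Z.
  by apply: finite_image; exact: finite_zero_angles.
pose s := undup s0; have us : uniq s by exact: undup_uniq.
have Zs t : angles t -> torus_eval p t = 0 -> (cis t.1 : C, cis t.2 : C) \in s.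
  move=> tA pt; rewrite mem_undup; have : Z (cis t.1, cis t.2) by exists t.
  by rewrite Zs0.
have sZ : [set` s] `<=` common_torus_zeros p (reversal p).
  move=> tau; rewrite /= mem_undup => ts.
  have [t [_ pt] <-] : Z tau by rewrite Zs0.
  split; rewrite /= ?norm_cis//; apply/eqP.
  by rewrite -modc_eq0 modc_reversal_torus ?norm_cis// modc_eq0; exact/eqP.
have mult_ge0 tau : (0 <= intersection_mult p (reversal p) tau)%E.
  exact: dim_mod_ge0.
have sum_le : (\sum_(tau <- s) intersection_mult p (reversal p) tau <=
    torus_mult p (reversal p))%E.
  apply: esum_ge; exists [set` s]; first by split => //; exact: finite_seq.
  by rewrite -fsbig_seq.
have [[tau ts tau_oo]|fin] := pselect (exists2 tau, tau \in s &
    intersection_mult p (reversal p) tau = +oo%E).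
  left; apply/eqP; rewrite -leye_eq; apply: le_trans sum_le.
  by rewrite (big_rem tau)//= tau_oo addye// -ltNye (lt_le_trans (ltNyr 0))// sume_ge0.
right.
have /choice[d hd] : forall tau, exists n, tau \in s ->
    (exists e : 'I_n -> pseries R, basis_mod (local_ideal tau p (reversal p)) e) /\
    intersection_mult p (reversal p) tau = n%:R%:E.
  move=> tau; have [ts|ts] := boolP (tau \in s); last by exists 0%N.
  have [tau_oo|[n [e [he E]]]] := dim_mod_attained (local_ideal tau p (reversal p)).
    by case: fin; exists tau.
  by exists n => _; split => //; exists e.
exists (\sum_(tau <- s) d tau)%N; split; last first.
  apply: le_trans sum_le; rewrite natr_sum -sumEFin le_eqVlt; apply/orP; left.
  by apply/eqP; apply: eq_big_seq => tau /hd[_ ->].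
rewrite big_distrr/=.
have hs : fincodim (\sum_(tau <- s) 3 * d tau)
    (fun Q => forall tau, tau \in s -> near_le p tau 2 (fun _ z1 z2 => Q.[z1, z2])).
  apply: fincodim_seq => tau /hd[[e he] _].
  rewrite (_ : 3 * d tau = d tau + (d tau + d tau))%N; last first.
    by rewrite mulSn mul2n addnn.
  apply: fincodim_local he => z1 z2; exact: modc_reversal_torus.
move=> m Q; have [A hA] := hs m Q; exists A => x /hA h.
apply: torus_le_local => t tA.
rewrite torus_evalM => /eqP; rewrite mulf_eq0 orbb => /eqP pt.
have [B [r [r0 hB]]] := near_le_const (h _ (Zs t tA pt)).
exists B, r; split=> // z1 z2 t1 t2 a1 a2.
by rewrite [p ^+ 2]expr2 !hornerM modcM -expr2; exact: hB.
Qed.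

End IndexCount.

Theorem corollary6p6 (R : realType) (p : {poly {poly R[i]}})
    (hp : atoral_stable p) :
  exists (M : nat) (idx : 'I_M.+1 -> \bar R),
    [/\ injective idx,
        idx ord_max = +oo%E,
        (forall x : \bar R,
           (x \is a fin_num /\ integrability_index (p ^+ 2) x) <->
           (exists2 j : 'I_M.+1, j != ord_max & idx j = x)),
        (M%:R%:E <= 4%:R%:E * torus_mult p (reversal p))%E &
        forall q : {poly {poly R[i]}},
          exists j : 'I_M.+1, idx j = Lp_sup (partial1 (ratfun q p))].
Proof.
pose X := [set x : R | integrability_index (p ^+ 2) x%:E].
have bound D s : fincodim D (torus_le (p ^+ 2)) -> uniq s ->
    (forall x, x \in s -> X x) -> (size s <= D)%N.
  move=> hD us sX.
  have hx (i : 'I_(size s)) : exists q, Lp_sup (ratfun q (p ^+ 2)) = (nth 0 s i)%:E.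
    by have [_ [q ->]] := sX _ (mem_nth 0 (ltn_ord i)); exists q.
  have [Q hQ] := choice hx.
  apply: (fincodim_index_bound hp hD _ hQ) => i j /eqP.
  by rewrite nth_uniq// => /eqP; exact: val_inj.
(* [M] is the largest length of a duplicate-free list of finite indices; the crude bound [D] makes
   it exist, and maximality forces such a list [s] to contain every index. *)
pose fam n := `[< exists s, [/\ uniq s, size s = n & forall x, x \in s -> X x] >].
have ex : exists n, fam n by exists 0%N; apply/asboolP; exists [::]; split.
have [D hD] := fincodim_sqr hp.
have famD n : fam n -> (n <= D)%N by move=> /asboolP[s [us <- sX]]; exact: bound.
case: (ex_maxnP ex famD) => M /asboolP[s [us sM sX]] Mmax.
have Xs x : X x -> x \in s.
  move=> Xx; apply/negPn/negP => xs.
  suff : fam M.+1 by move=> /Mmax; rewrite ltnn.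
  apply/asboolP; exists (x :: s); split; rewrite /= ?xs ?sM//.
  by move=> y; rewrite in_cons => /orP[/eqP->|/sX].
(* The value [+oo] comes last, so it sits at [ord_max]. *)
pose S := rcons (map EFin s) +oo%E.
have sS : size S = M.+1 by rewrite size_rcons size_map sM.
have uS : uniq S.
  rewrite rcons_uniq map_inj_uniq ?us ?andbT; last by move=> x y [].
  by apply/negP => /mapP[].
have S_lt j : (j < M)%N -> nth +oo%E S j = (nth 0 s j)%:E.
  by move=> jM; rewrite nth_rcons size_map sM jM (nth_map 0) ?sM.
have S_max : nth +oo%E S M = +oo%E.
  by rewrite nth_rcons size_map sM ltnn eqxx.
have Sfin x : X x -> exists2 j : 'I_M.+1, j != ord_max & nth +oo%E S j = x%:E.
  move=> /Xs xs; have jM : (index x s < M)%N by rewrite -sM index_mem.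
  exists (widen_ord (leqnSn M) (Ordinal jM)) => /=.
    by rewrite -val_eqE/= neq_ltn jM.
  by rewrite S_lt// nth_index.
exists M, (fun j => nth +oo%E S j); split.
- move=> i j /eqP; rewrite nth_uniq ?sS// => /eqP; exact: val_inj.
- exact: S_max.
- move=> x; split.
    by case: x => [x||] [] // _; exact: Sfin.
  move=> [j jmax <-].
  have jM : (j < M)%N.
    by rewrite ltn_neqAle -ltnS ltn_ord andbT; move: jmax; rewrite -val_eqE.
  by rewrite S_lt//; split=> //; apply: sX; rewrite mem_nth// sM.
- have [->|[N [hN leN]]] := fincodim_torus_mult hp.
    by rewrite gt0_muley ?lte_fin ?leey.
  apply: (@le_trans _ _ (4%:R%:E * N%:R%:E)%E); last first.
    by apply: lee_wpmul2l; rewrite ?lee_fin.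
  rewrite -EFinM -natrM lee_fin ler_nat -sM.
  by apply: leq_trans (bound _ _ hN us sX) _; rewrite leq_mul2r orbT.
(* Positivity rules out -oo; a finite supremum is an index by definition, and [+oo] is the last
   entry of [S]. *)
- move=> q; rewrite Lp_sup_partial1//; have := Lp_sup_gt0 hp (partial1_num q p).
  have : forall v, v = Lp_sup (ratfun (partial1_num q p) (p ^+ 2)) ->
      (0 < v)%E -> exists j : 'I_M.+1, nth +oo%E S j = v.
    case=> [v||] //; last by move=> _ _; exists ord_max.
    move=> vE v0; have [j _ jv] := Sfin v (conj v0 (ex_intro _ _ vE)).
    by exists j.
  by apply.
Qed.
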